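(* Let $\varepsilon>0$ and let $\ell>0$ be an integer. For any $a\in[-1,1]$ there exists a sequence $\{n_i\}_{i\ge1}$ of elements of $S$ with $N_{n_i}\to\infty$ as $i\to\infty$ such that $\hat\nu_{n_i}(4)\to a$ and, for every $i$ and $t=1,2$: (i) $\mathcal{V}^t(n_i,\ell,n_i^{1/2-\varepsilon})=\emptyset$; (ii) $|\xi_t|\ge n_i^{1/2-\varepsilon}$ for all $\xi=(\xi_1,\xi_2)\in\mathbb{Z}^2$ with $|\xi|^2=n_i$.
   Context: $S$ is the set of positive integers $n$ of the form $n=a^2+b^2$ with $a,b\in\mathbb{Z}$. For $n\in S$, $N_n$ is the number of $\xi=(\xi_1,\xi_2)\in\mathbb{Z}^2$ with $|\xi|^2=n$; $\nu_n=\frac1{N_n}\sum_{|\xi|^2=n}\delta_{\xi/\sqrt n}$ is a probability measure on the unit circle $\mathbb{S}^1$, and $\hat\nu_n(4)=\int_{\mathbb{S}^1}\cos(4\theta)\,d\nu_n(\theta)$. For $K>0$ and $t\in\{1,2\}$, $\mathcal{V}^t(n,\ell,K)$ is the set of $\ell$-tuples $(\xi^1,\dots,\xi^\ell)$ of points $\xi^j=(\xi_1^j,\xi_2^j)\in\mathbb{Z}^2$ with $|\xi^j|^2=n$ satisfying $0<|\xi_t^1+\dots+\xi_t^\ell|\le K$. *)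

(* Defs.v *)
From HB Require Import structures.
From mathcomp Require Export all_boot all_order all_algebra finmap.
From mathcomp Require Export all_classical all_reals all_analysis.
From mathcomp Require Import measurable_realfun ring lra zify.
Export numFieldNormedType.Exports.
Import Order.TTheory GRing.Theory Num.Theory.

Set Implicit Arguments.
Unset Strict Implicit.
Unset Printing Implicit Defensive.

Local Open Scope classical_set_scope.
Local Open Scope ring_scope.

Definition sums_of_two_squares : set nat :=
  [set n | (0 < n)%N /\ exists a b : int, n%:Z = a ^+ 2 + b ^+ 2].

Definition lattice_points (n : nat) : set (int * int) :=
  [set xi | xi.1 ^+ 2 + xi.2 ^+ 2 = n%:Z].

Lemma lattice_points_finite n : finite_set (lattice_points n).
Proof.
pose f (i : nat) : int := i%:Z - n%:Z.
apply: (@sub_finite_set _ _ ((f @` `I_(n.*2.+1)) `*` (f @` `I_(n.*2.+1)))).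
  have bnd (x y : int) : x ^+ 2 + y ^+ 2 = n%:Z -> (f @` `I_(n.*2.+1)) x.
    move=> h; have y2 : 0 <= y ^+ 2 by exact: sqr_ge0.
    have : `|x| <= x ^+ 2.
      have [->|x0] := eqVneq x 0; first by rewrite normr0 expr0n.
      rewrite -real_normK ?num_real// expr2 ler_peMr//.
      by move: x0; rewrite -normr_gt0; lia.
    move: (x ^+ 2) (y ^+ 2) h y2 => X Y h y2 hX.
    by exists (absz (x + n%:Z)); rewrite /f /=; lia.
  move=> [x y] /= h; split=> /=; first exact: (bnd x y).
  by apply: (bnd y x); rewrite addrC.
by apply: finite_setX; apply: finite_image; exact: finite_II.
Qed.

(* Since [lattice_points n] is finite, [fset_set] enumerates it exactly. *)
Definition lattice_seq (n : nat) : seq (int * int) :=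
  enum_fset (fset_set (lattice_points n)).

Lemma mem_lattice_seq n xi : (xi \in lattice_seq n) <-> lattice_points n xi.
Proof.
rewrite /lattice_seq; split=> [h|h].
  by have : xi \in fset_set (lattice_points n) by [];
    rewrite in_fset_set ?inE//; exact: lattice_points_finite.
suff : xi \in fset_set (lattice_points n) by [].
by rewrite in_fset_set ?inE//; exact: lattice_points_finite.
Qed.

Lemma lattice_seq_uniq n : uniq (lattice_seq n).
Proof. exact: fset_uniq. Qed.

Definition N (n : nat) : nat := size (lattice_seq n).

Lemma N_gt0 n : sums_of_two_squares n -> (0 < N n)%N.
Proof.
move=> [_ [a [b hab]]]; rewrite /N.
have : (a, b) \in lattice_seq n by apply/mem_lattice_seq; rewrite /lattice_points/=.
by case: (lattice_seq n).
Qed.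

Section circle_measure.
Variable R : realType.

Definition unit_circle : set (R * R) := [set z | z.1 ^+ 2 + z.2 ^+ 2 = 1].

(* The argument in ]-pi, pi] of a point of the unit circle. *)
Definition angle (z : R * R) : R :=
  if 0 <= z.2 then acos z.1 else - acos z.1.

Lemma unit_circle_bound z : unit_circle z -> -1 <= z.1 <= 1.
Proof. by rewrite /unit_circle/= => h; apply/andP; split; nra. Qed.

Lemma cos_angle z : unit_circle z -> cos (angle z) = z.1.
Proof.
move=> hz; have hb := unit_circle_bound hz.
by rewrite /angle; case: ifP => _; rewrite ?cosN acosK// in_itv.
Qed.

Lemma sin_angle z : unit_circle z -> sin (angle z) = z.2.
Proof.
move=> hz; have hb := unit_circle_bound hz.
have e : 1 - z.1 ^+ 2 = z.2 ^+ 2 by rewrite -hz; ring.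
rewrite /angle; case: ifPn => h2; rewrite ?sinN sin_acos// e sqrtr_sqr.
  by rewrite ger0_norm.
by rewrite ltr0_norm ?opprK// ltNge.
Qed.

Definition project (n : nat) (xi : int * int) : R * R :=
  (xi.1%:~R / Num.sqrt n%:R, xi.2%:~R / Num.sqrt n%:R).

Lemma project_unit_circle n xi : (0 < n)%N -> lattice_points n xi ->
  unit_circle (project n xi).
Proof.
move=> n0; rewrite /lattice_points/unit_circle/= => h.
rewrite !expr_div_n sqr_sqrtr// -mulrDl -!rmorphXn/= -intrD h.
by rewrite pmulrn divff// pnatr_eq0 -lt0n.
Qed.

Definition nu (n : nat) : {measure set (R * R) -> \bar R} :=
  mscale ((N n)%:R^-1)%:nng
    (msum (fun k => \d_(project n (nth (0, 0) (lattice_seq n) k))) (N n)).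

Lemma nuE n (A : set (R * R)) :
  nu n A = ((N n)%:R^-1%:E * \sum_(xi <- lattice_seq n) \d_(project n xi) A)%E.
Proof.
by rewrite /nu/= /mscale/= /msum (big_nth (0, 0)) big_mkord.
Qed.

Lemma nu_unit_circle n : sums_of_two_squares n ->
  nu n unit_circle = 1%E /\ nu n setT = 1%E.
Proof.
move=> hn; have N0 := N_gt0 hn; have [n0 _] := hn.
suff H A : (forall xi, lattice_points n xi -> A (project n xi)) -> nu n A = 1%E.
  by split; apply: H => // xi; exact: project_unit_circle.
move=> hA; rewrite nuE big_seq (eq_bigr (fun=> 1%E)); last first.
  by move=> xi /mem_lattice_seq /hA h; rewrite diracE mem_set.
rewrite -big_seq big_const_seq count_predT -/(N n).
have -> : iter (N n) (adde 1%E) 0%E = (N n)%:R%:E :> \bar R.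
  by elim: (N n) => //= m ->; rewrite -natr1 [RHS]EFinD addeC.
by rewrite -EFinM mulVf// pnatr_eq0 -lt0n.
Qed.

Definition nu_hat4 (n : nat) : R :=
  \int[nu n]_(z in unit_circle) cos (4 * angle z).

Lemma measurable_unit_circle : measurable unit_circle.
Proof.
pose g (z : R * R) : R := z.1 ^+ 2 + z.2 ^+ 2.
have mg : measurable_fun setT g.
  by apply: measurable_funD; apply: measurable_funX; [exact: measurable_fst|exact: measurable_snd].
by have := mg measurableT [set 1] (measurable_set1 _); rewrite setTI.
Qed.

Lemma cos4_angle (z : R * R) : unit_circle z ->
  cos (4 * angle z) = 8 * z.1 ^+ 4 - 8 * z.1 ^+ 2 + 1.
Proof.
move=> /cos_angle <-; set t := angle z.
have -> : 4 * t = (t *+ 2) *+ 2 by rewrite -mulrnA mulr_natl.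
rewrite !cos_mulr2n; ring.
Qed.

Lemma measurable_cos4 : measurable_fun unit_circle (fun z => cos (4 * angle z)).
Proof.
apply: (@eq_measurable_fun _ _ _ _ _ (fun z : R * R => 8 * z.1 ^+ 4 - 8 * z.1 ^+ 2 + 1)).
  by move=> z /set_mem /cos4_angle.
apply: measurable_funTS; apply: measurable_funD => //; apply: measurable_funB;
  apply: measurable_funM => //; apply: measurable_funX; exact: measurable_fst.
Qed.

Lemma ge0_integral_nu n (f : R * R -> R) : (0 < n)%N ->
  measurable_fun unit_circle f -> (forall z, 0 <= f z) ->
  (\int[nu n]_(z in unit_circle) (f z)%:E =
   ((N n)%:R^-1 * \sum_(xi <- lattice_seq n) f (project n xi))%:E)%E.
Proof.
move=> n0 mf f0.
have mE : measurable_fun unit_circle (EFin \o f) by exact/measurable_EFinP.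
have mC := measurable_unit_circle.
rewrite ge0_integral_mscale//; last by move=> x _; rewrite lee_fin.
rewrite ge0_integral_measure_sum//; last by move=> x _; rewrite lee_fin.
rewrite EFinM; congr (_ * _)%E.
rewrite (big_nth (0, 0)) big_mkord -sumEFin; apply: eq_bigr => k _.
rewrite integral_dirac// diracE mem_set ?mul1e//.
by apply: project_unit_circle => //; apply/mem_lattice_seq; exact: mem_nth.
Qed.

Lemma nu_hat4E n : (0 < n)%N -> nu_hat4 n =
  (N n)%:R^-1 * \sum_(xi <- lattice_seq n) cos (4 * angle (project n xi)).
Proof.
move=> n0; rewrite /nu_hat4 /Rintegral integralE.
pose c (z : R * R) := cos (4 * angle z).
rewrite -/(EFin \o c) (funerpos c) (funerneg c).
rewrite !ge0_integral_nu//.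
- rewrite -EFinB/= -mulrBr -sumrB; congr (_ * _); apply: eq_bigr => xi _.
  by have /(congr1 (fun h => h (project n xi))) := funrposBneg c.
- by apply: measurable_funrneg; exact: measurable_cos4.
- by apply: measurable_funrpos; exact: measurable_cos4.
Qed.

End circle_measure.

(* The coordinates are numbered by 'I_2, from 0. *)
Definition coord (t : 'I_2) (xi : int * int) : int :=
  if t == ord0 then xi.1 else xi.2.

Definition V (R : realType) (t : 'I_2) (n l : nat) (K : R) :
    set (l.-tuple (int * int)) :=
  [set xi | (forall j : 'I_l, lattice_points n (tnth xi j)) /\
    0 < (`|\sum_(j < l) coord t (tnth xi j)|%:~R : R) <= K].

Arguments V {R} t n l K.

(* Main.v *)
(* The points of norm 9^m n are 3^m times the points of norm n, so multiplying n
   by 9^m changes neither N_n nor the Fourier coefficient, while every nonzero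
   integer combination of coordinates becomes at least 3^m in absolute value.
   Hence (i) and (ii) hold for large m as soon as no point of norm n lies on an
   axis, and it remains to realise every value a by such n with N_n large.

   Let p be a Gaussian prime with u = (p/|p|)^4 close to, but different from, 1.
   For n = |p|^(2(2m+1)) the coefficient is the mean of Re u, Re u^3, ...,
   Re u^(2m+1); as m grows it moves from about 1 to 0 in small steps, hence
   approximates every a in [0, 1].  Replacing n by 2n changes its sign.

   Such primes exist: the Hecke L-series of the characters (z/|z|)^(4k), k > 0,
   are bounded as s -> 1+, so their Euler products bound from above the sums of
   Re u_p^k |p|^(-2s) over the primes p, whereas the sum of |p|^(-2s) is
   unbounded.  If every u_p were 1 or far from 1, some combination of the Re u^k,
   k > 0, with nonnegative coefficients would be at least 1 at every u_p, a
   contradiction. *)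

(* The prime can only be chosen after the tolerance d. The steps of the means are at most d only
   from an index J of size about 1/d on, so u must be so close to 1 that its first 2J + 1 powers are
   still near 1; yet u must differ from 1, since otherwise the means never leave 1. Once u^2 differs
   from 1, unique factorisation shows that u is not a root of unity, and there are exactly 4(k + 1)
   points of norm |p|^(2k). The exponent k is odd because for even k the product of p^(k/2) and its
   conjugate lies on an axis; an odd k leaves only odd frequencies, which pair off with their
   opposites. Sums over the Gaussian integers are limits along finite subsets: the sieve and the
   splitting into residue classes reindex them by multiplication by a prime and by affine maps,
   which respect no enumeration. *)
From HB Require Import structures.
Require Import Defs.
From mathcomp Require Import complex ring lra zify.
Import Order.TTheory GRing.Theory Num.Theory.
Import Normc.

Local Notation Re := complex.Re.
Local Notation Im := complex.Im.

Set Implicit Arguments.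
Unset Strict Implicit.
Unset Printing Implicit Defensive.

Local Open Scope classical_set_scope.
Local Open Scope fset_scope.
Local Open Scope ring_scope.
Local Open Scope complex_scope.

(** * Gaussian integers *)

(* A copy is needed because [int * int] already carries the product ring
   structure. *)
Definition gauss := (int * int)%type.

HB.instance Definition _ := GRing.Zmodule.copy gauss (int * int)%type.

Definition gmul (z w : gauss) : gauss :=
  (z.1 * w.1 - z.2 * w.2, z.1 * w.2 + z.2 * w.1).

Lemma gmulA : associative gmul.
Proof. by move=> [a b] [c d] [e f]; rewrite /gmul /=; congr pair; ring. Qed.

Lemma gmulC : commutative gmul.
Proof. by move=> [a b] [c d]; rewrite /gmul /=; congr pair; ring. Qed.

Lemma gmul1 : left_id ((1, 0) : gauss) gmul.
Proof. by move=> [a b]; rewrite /gmul /=; congr pair; ring. Qed.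

Lemma gmulDl : left_distributive gmul +%R.
Proof. by move=> [a b] [c d] [e f]; rewrite /gmul /=; congr pair => /=; ring. Qed.

Lemma gone_neq0 : ((1, 0) : gauss) != 0.
Proof. by []. Qed.

HB.instance Definition _ :=
  GRing.Zmodule_isComNzRing.Build gauss gmulA gmulC gmul1 gmulDl gone_neq0.

Definition gnorm (z : gauss) : nat := absz (z.1 ^+ 2 + z.2 ^+ 2).
Arguments gnorm z%_R.
Definition gconj (z : gauss) : gauss := (z.1, - z.2).

Section GaussDivisibility.
Implicit Types (z w p q v : gauss).

Lemma gmulE z w : z * w = (z.1 * w.1 - z.2 * w.2, z.1 * w.2 + z.2 * w.1).
Proof. by []. Qed.
Lemma gaddE z w : z + w = (z.1 + w.1, z.2 + w.2).
Proof. by []. Qed.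
Lemma goppE z : - z = (- z.1, - z.2).
Proof. by []. Qed.

Lemma gnormE z : (gnorm z)%:Z = z.1 ^+ 2 + z.2 ^+ 2.
Proof. by rewrite /gnorm gez0_abs // addr_ge0 // sqr_ge0. Qed.

Lemma gnormM z w : gnorm (z * w) = (gnorm z * gnorm w)%N.
Proof.
apply/eqP; rewrite -eqz_nat PoszM !gnormE gmulE /=; apply/eqP; ring.
Qed.

Lemma gnorm_eq0 z : (gnorm z == 0)%N = (z == 0).
Proof.
rewrite -eqz_nat gnormE paddr_eq0 ?sqr_ge0 // !sqrf_eq0.
by case: z.
Qed.

Lemma gnorm_gt0 z : (0 < gnorm z)%N = (z != 0).
Proof. by rewrite lt0n gnorm_eq0. Qed.

Lemma gnormN z : gnorm (- z) = gnorm z.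
Proof. by rewrite /gnorm goppE /= !sqrrN. Qed.

Lemma gnorm_conj z : gnorm (gconj z) = gnorm z.
Proof. by rewrite /gnorm /gconj /= sqrrN. Qed.

Lemma gmul_conj z : z * gconj z = ((gnorm z)%:Z, 0).
Proof. by rewrite gmulE gnormE /gconj /=; congr pair; ring. Qed.

Lemma gconjM z w : gconj (z * w) = gconj z * gconj w.
Proof. by rewrite !gmulE /gconj /=; congr pair; ring. Qed.

Lemma gconjK : involutive gconj.
Proof. by case=> a b; rewrite /gconj /= opprK. Qed.

Lemma gmul_eq0 z w : (z * w == 0) = (z == 0) || (w == 0).
Proof. by rewrite -!gnorm_eq0 gnormM muln_eq0. Qed.

Lemma gmulI z : z != 0 -> injective ( *%R z).
Proof.
move=> z0 x y /eqP; rewrite -subr_eq0 -mulrBr gmul_eq0 (negPf z0) /=.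
by rewrite subr_eq0 => /eqP.
Qed.

Lemma gnorm1 : gnorm 1 = 1%N.
Proof. by []. Qed.

Lemma gnormX z k : gnorm (z ^+ k) = (gnorm z ^ k)%N.
Proof. by elim: k => // k ih; rewrite exprS gnormM ih expnS. Qed.

Lemma gunitP z : gnorm z = 1%N ->
  [\/ z = (1, 0), z = (-1, 0), z = (0, 1) | z = (0, -1)].
Proof.
move=> /(congr1 Posz); rewrite gnormE; case: z => a b /= h.
have a1 : -1 <= a <= 1 by apply/andP; split; nia.
have b1 : -1 <= b <= 1 by apply/andP; split; nia.
have: (a = -1) \/ (a = 0) \/ (a = 1) by lia.
have: (b = -1) \/ (b = 0) \/ (b = 1) by lia.
by case=> [hb|[hb|hb]] [ha|[ha|ha]]; move: h; subst a b => // _;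
 [constructor 4|constructor 2|constructor 1|constructor 3].
Qed.

Definition gdvd p z := exists q, z = p * q.

Lemma gdvd_mull p z w : gdvd p z -> gdvd p (w * z).
Proof. by case=> q ->; exists (w * q); rewrite mulrCA. Qed.

Lemma gdvd_mulr p z w : gdvd p z -> gdvd p (z * w).
Proof. by rewrite mulrC; exact: gdvd_mull. Qed.

Lemma gdvdD p z w : gdvd p z -> gdvd p w -> gdvd p (z + w).
Proof. by case=> a -> [b ->]; exists (a + b); rewrite mulrDr. Qed.

Lemma gdvd_trans q p z : gdvd p q -> gdvd q z -> gdvd p z.
Proof. by case=> a -> [b ->]; exists (a * b); rewrite mulrA. Qed.

Lemma gdvdxx p : gdvd p p.
Proof. by exists 1; rewrite mulr1. Qed.

Lemma gdvd_conj p z : gdvd p z -> gdvd (gconj p) (gconj z).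
Proof. by case=> q ->; exists (gconj q); rewrite gconjM. Qed.

Lemma gdvd_norm p z : gdvd p z -> (gnorm p %| gnorm z)%N.
Proof. by case=> q ->; rewrite gnormM dvdn_mulr. Qed.

Lemma round_div (a b : int) : 0 < b -> exists q : int, `|a - q * b| *+ 2 <= b.
Proof.
move=> b0; exists ((2 * a + b) %/ (2 * b))%Z.
have := divz_eq (2 * a + b) (2 * b).
have : 0 <= ((2 * a + b) %% (2 * b))%Z by apply: modz_ge0; lia.
have : ((2 * a + b) %% (2 * b))%Z < 2 * b by apply: ltz_pmod; lia.
move: (_ %/ _)%Z (_ %% _)%Z => q r; rewrite mulr2n; nia.
Qed.

Lemma geuclid z w : w != 0 -> exists q, (gnorm (z - q * w) < gnorm w)%N.
Proof.
move=> w0; have nw : 0 < (gnorm w)%:Z by rewrite ltz_nat gnorm_gt0.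
have [q1 h1] := round_div (z * gconj w).1 nw.
have [q2 h2] := round_div (z * gconj w).2 nw.
exists (q1, q2).
(* Multiplying by [gnorm (gconj w)] turns z / w into z * gconj w over the integer n = |w|^2. Each
   coordinate leaves a remainder of at most n / 2, so the norm is at most n^2 / 2 < n^2. *)
rewrite -(ltn_pmul2r (m := gnorm w)) ?gnorm_gt0 //.
rewrite -{1}(gnorm_conj w) -gnormM mulrBl -mulrA gmul_conj.
rewrite -ltz_nat gnormE PoszM.
move: (z * gconj w) (Posz (gnorm w)) nw h1 h2 => [a b] n n0 /= h1 h2.
rewrite !mulr0 subr0 add0r.
move: (a - q1 * n) (b - q2 * n) h1 h2 => x y.
rewrite !mulr2n; nia.
Qed.

Definition gprime p :=
  (1 < gnorm p)%N /\ forall a b, p = a * b -> gnorm a = 1%N \/ gnorm b = 1%N.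

Lemma gprime_neq0 p : gprime p -> p != 0.
Proof. by case=> p1 _; rewrite -gnorm_gt0; apply: ltnW. Qed.

(** Bezout: an element g of least norm in the ideal generated by p and z divides both. As p is
    irreducible, either g is a unit, and p divides g w, a combination of p w and z w; or g is an
    associate of p, and p divides z because g does. *)
Lemma gprime_dvdM p z w : gprime p -> gdvd p (z * w) -> gdvd p z \/ gdvd p w.
Proof.
move=> pp pzw; have p0 := gprime_neq0 pp.
pose I g := exists x y, g = x * p + y * z.
have Ip : I p by exists 1, 0; ring.
have Iz : I z by exists 0, 1; ring.
have [g [g0 Ig mg]] : exists g, [/\ g != 0, I g &
    forall h, I h -> h != 0 -> (gnorm g <= gnorm h)%N].
  have ex : exists n, `[< exists g, [/\ g != 0, I g & gnorm g = n] >].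
    by exists (gnorm p); apply/asboolP; exists p.
  case: (ex_minnP ex) => n /asboolP[g [g0 Ig <-]] mn.
  by exists g; split=> // h Ih h0; apply: mn; apply/asboolP; exists h.
have Idvd h : I h -> gdvd g h.
  move=> Ih; have [q hq] := geuclid h g0.
  have Ir : I (h - q * g).
    case: Ih => x [y ->]; case: Ig => x' [y' ->].
    by exists (x - q * x'), (y - q * y'); ring.
  have [/eqP|r0] := eqVneq (h - q * g) 0.
    by rewrite subr_eq0 => /eqP ->; exists q; rewrite mulrC.
  by have := mg _ Ir r0; rewrite leqNgt hq.
have [h ph] := Idvd _ Ip.
have [t zt] := Idvd _ Iz.
have [g1|h1] := pp.2 _ _ ph.
  right; apply: (@gdvd_trans (g * w)).
    case: Ig => x [y ->]; rewrite mulrDl; apply: gdvdD.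
      by apply: gdvd_mulr; apply: gdvd_mull; exact: gdvdxx.
    by rewrite -mulrA; apply: gdvd_mull.
  by exists (gconj g); rewrite mulrAC gmul_conj g1 mul1r.
left; rewrite zt; apply: gdvd_mulr.
exists (gconj h); by rewrite ph -mulrA gmul_conj h1 mulr1.
Qed.

Lemma gprime_dvdX p z k : gprime p -> gdvd p (z ^+ k) -> gdvd p z.
Proof.
move=> pp; elim: k => [/gdvd_norm|k ih]; last first.
  by rewrite exprS => /(gprime_dvdM pp)[].
by rewrite expr0 gnorm1 dvdn1 => /eqP h; case: pp; rewrite h.
Qed.

Lemma gprime_ex z : (1 < gnorm z)%N -> exists2 p, gprime p & gdvd p z.
Proof.
have [n] := ubnP (gnorm z); elim: n z => // n ih z zn z1.
have [pz|] := pselect (gprime z); first by exists z => //; exact: gdvdxx.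
move=> npz; have : ~ forall a b, z = a * b -> gnorm a = 1%N \/ gnorm b = 1%N.
  by move=> h; apply: npz.
move=> /existsNP[a /existsNP[b /not_implyP[zab /not_orP[a1 b1]]]].
have nz : gnorm z = (gnorm a * gnorm b)%N by rewrite zab gnormM.
have [//||p pp pa] := ih a; [nia|nia|].
by exists p => //; rewrite zab; apply: gdvd_mulr.
Qed.

(** A half-open quadrant is a fundamental domain for multiplication by the four units. *)
Definition quad1 z := (0 < z.1) && (0 <= z.2).

Lemma quad1_assoc z : z != 0 -> exists2 v, gnorm v = 1%N & quad1 (v * z).
Proof.
case: z => a b z0; have : a != 0 \/ b != 0.
  by apply/orP; rewrite -negb_and; apply: contra z0 => /andP[/eqP -> /eqP ->].
move=> h; have [h1|h1] := ltP 0 a; have [h2|h2] := ltP 0 b.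
- by exists (1, 0); rewrite // /quad1 gmulE /=; lia.
- have [b0|b0] := eqVneq b 0.
    by exists (1, 0); rewrite // /quad1 gmulE /=; lia.
  by exists (0, 1); rewrite // /quad1 gmulE /=; lia.
- by exists (0, -1); rewrite // /quad1 gmulE /=; lia.
- have [a0|a0] := eqVneq a 0.
    by exists (0, 1); rewrite // /quad1 gmulE /=; lia.
  by exists (-1, 0); rewrite // /quad1 gmulE /=; lia.
Qed.

Lemma quad1_uniq z v : quad1 z -> gnorm v = 1%N -> quad1 (z * v) -> v = 1.
Proof.
case: z => a b; rewrite /quad1 gmulE /= => h1 /gunitP h2 h3.
by move: h2 h3 => [] -> //=; lia.
Qed.

Lemma quad1_dvd p q : quad1 p -> quad1 q -> gprime p -> gprime q ->
  gdvd p q -> p = q.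
Proof.
move=> p1 q1 pp qp [v qv]; have [h|h] := qp.2 _ _ qv.
  by case: pp; rewrite h.
by move: q1; rewrite qv => /(quad1_uniq p1 h) ->; rewrite mulr1.
Qed.

End GaussDivisibility.

(** * Unconditional sums *)

Definition has_sum (R : realType) (T : choiceType) (f : T -> R) (l : R) :=
  forall e : R, 0 < e -> exists A0 : {fset T}, forall A : {fset T}, A0 `<=` A ->
    `|\sum_(x <- A) f x - l| <= e.

Definition abs_bounded (R : realType) (T : choiceType) (f : T -> R) (B : R) :=
  forall A : {fset T}, \sum_(x <- A) `|f x| <= B.

Section HasSum.
Variables (R : realType) (T : choiceType).
Implicit Types (f g : T -> R) (l B : R) (A : {fset T}).

Lemma has_sum_ext f g l : f =1 g -> has_sum f l -> has_sum g l.
Proof.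
move=> fg hf e /hf[A0 hA]; exists A0 => A /hA.
by rewrite (eq_bigr g) // => i _; rewrite fg.
Qed.

Lemma has_sum_uniq f l l' : has_sum f l -> has_sum f l' -> l = l'.
Proof.
move=> h h'; apply/eqP; rewrite -subr_eq0 -normr_le0; apply/ler_addgt0Pr => e e0.
rewrite add0r; have e2 : 0 < e / 2 by rewrite divr_gt0.
have [A0 hA] := h _ e2; have [A1 hA1] := h' _ e2.
have := hA _ (fsubsetUl A0 A1); have := hA1 _ (fsubsetUr A0 A1).
move: (\sum_(_ <- _) _) => S; rewrite !ler_norml => /andP[a b] /andP[c d].
by apply/andP; split; lra.
Qed.

Lemma has_sumD f g l l' : has_sum f l -> has_sum g l' ->
  has_sum (fun x => f x + g x) (l + l').
Proof.
move=> h h' e e0; have e2 : 0 < e / 2 by rewrite divr_gt0.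
have [A0 hA] := h _ e2; have [A1 hA1] := h' _ e2; exists (A0 `|` A1) => A.
rewrite fsubUset => /andP[/hA a /hA1 b]; rewrite big_split /= opprD addrACA.
by rewrite (le_trans (ler_normD _ _)) // (splitr e) lerD.
Qed.

Lemma has_sumZ f l c : has_sum f l -> has_sum (fun x => c * f x) (c * l).
Proof.
move=> h e e0; have c1 : 0 < `|c| + 1 by rewrite ltr_wpDl.
have [A0 hA] := h _ (divr_gt0 e0 c1); exists A0 => A /hA {}hA.
rewrite -mulr_sumr -mulrBr normrM (le_trans (ler_wpM2l _ hA)) //.
by rewrite mulrA ler_pdivrMr // mulrC ler_wpM2l ?lerDl // ltW.
Qed.

Lemma has_sumB f g l l' : has_sum f l -> has_sum g l' ->
  has_sum (fun x => f x - g x) (l - l').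
Proof.
move=> hf /(has_sumZ (-1)); rewrite mulN1r => /(has_sumD hf).
by apply: has_sum_ext => x; rewrite mulN1r.
Qed.

Lemma has_sum_norm_le f l B : has_sum f l ->
  (forall A, `|\sum_(x <- A) f x| <= B) -> `|l| <= B.
Proof.
move=> h hB; apply/ler_addgt0Pr => e e0; have [A hA] := h _ e0.
have := hA _ (fsubset_refl A); have := hB A.
move: (\sum_(_ <- _) _) => S a b.
by have := ler_normB S (S - l); rewrite opprB addrC subrK; lra.
Qed.

Lemma abs_bounded_le f B A : abs_bounded f B -> `|\sum_(x <- A) f x| <= B.
Proof. by move=> /(_ A); apply: le_trans; exact: ler_norm_sum. Qed.

Lemma has_sum_le f l B : has_sum f l -> abs_bounded f B -> `|l| <= B.
Proof. by move=> h hB; apply: (has_sum_norm_le h) => A; exact: abs_bounded_le. Qed.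

Lemma ler_sum_fset f A A' : (forall x, 0 <= f x) -> A `<=` A' ->
  \sum_(x <- A) f x <= \sum_(x <- A') f x.
Proof.
move=> f0 AA'; rewrite [leRHS](big_fsetID _ (mem A)) /=.
have -> : [fset x in A' | x \in A] = A.
  by apply/fsetP => x; rewrite !inE andbC; case: (boolP (x \in A)) => // /(fsubsetP AA').
by rewrite lerDl sumr_ge0.
Qed.

Lemma has_sum_ge f l A : (forall x, 0 <= f x) -> has_sum f l ->
  \sum_(x <- A) f x <= l.
Proof.
move=> f0 h; apply/ler_addgt0Pr => e e0; have [A0 hA] := h _ e0.
have := hA _ (fsubsetUl A0 A); rewrite ler_norml => /andP[_].
have := ler_sum_fset f0 (fsubsetUr A0 A); lra.
Qed.

Lemma has_sum_ex_ge0 f B : (forall x, 0 <= f x) -> abs_bounded f B ->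
  exists l, has_sum f l.
Proof.
move=> f0 hB; pose S := [set \sum_(x <- A) f x | A in [set: {fset T}]]%classic.
have bS : has_ubound S.
  exists B => _ [A _ <-]; apply: le_trans (hB A); apply: ler_sum => x _.
  exact: ler_norm.
have hS : has_sup S by split=> //; exists (\sum_(x <- fset0) f x), fset0.
exists (sup S) => e e0.
have [_ [A0 _ <-] h0] := sup_adherent e0 hS.
exists A0 => A /(ler_sum_fset f0) h1.
have h2 : \sum_(x <- A) f x <= sup S by apply: ub_le_sup => //; exists A.
rewrite ler_norml; apply/andP; split; lra.
Qed.

Lemma has_sum_ex f B : abs_bounded f B -> exists l, has_sum f l.
Proof.
move=> hB.
have [l1 h1] : exists l, has_sum (fun x => `|f x|) l.
  apply: (@has_sum_ex_ge0 _ B) => // A; under eq_bigr do rewrite normr_id.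
  exact: hB.
have [l2 h2] : exists l, has_sum (fun x => `|f x| + f x) l.
  apply: (@has_sum_ex_ge0 _ (B + B)) => [x|A].
    by have := lerNnormlW (lexx `|f x|); lra.
  apply: (@le_trans _ _ (\sum_(x <- A) (`|f x| + `|f x|))).
    apply: ler_sum => x _; rewrite (le_trans (ler_normD _ _)) //.
    by rewrite normr_id.
  by rewrite big_split /= lerD.
by exists (l2 - l1); apply: has_sum_ext (has_sumB h2 h1) => x; rewrite addrC addKr.
Qed.

Lemma has_sum_sum (I : Type) (r : seq I) (F : I -> T -> R) (L : I -> R) :
  (forall i, has_sum (F i) (L i)) ->
  has_sum (fun x => \sum_(i <- r) F i x) (\sum_(i <- r) L i).
Proof.
move=> h; elim: r => [|i r ih].
  move=> e e0; exists fset0 => A _; rewrite big_nil subr0.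
  by rewrite big1 ?normr0 ?ltW // => x _; rewrite big_nil.
rewrite big_cons; apply: has_sum_ext (has_sumD (h i) ih) => x.
by rewrite big_cons.
Qed.

End HasSum.

Section Push.
Variables (R : realType) (T U : choiceType).

(** This reads a sum over the multiples of a prime, or over a residue class, as a sum over all
    Gaussian integers. *)
Lemma has_sum_push (g : T -> U) (f : T -> R) (h : U -> R) l :
  injective g -> (forall x, h (g x) = f x) ->
  (forall y, (forall x, y <> g x) -> h y = 0) ->
  has_sum f l -> has_sum h l.
Proof.
move=> gi hg h0 hf e /hf[A0 hA]; exists (g @` A0) => A sA.
pose ginv y := if pselect (exists x, y = g x) is left H
  then Some (projT1 (cid H)) else None.
have ginvK x : ginv (g x) = Some x.
  rewrite /ginv; case: pselect => [H|[]]; last by exists x.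
  by case: cid => x' /= /gi ->.
have ginvE y x : ginv y = Some x -> y = g x.
  by rewrite /ginv; case: pselect => // H; case: cid => x' /= -> [->].
pose A1 : {fset T} := [fset x in pmap ginv A].
have A1E x : (x \in A1) = (g x \in A).
  rewrite !inE mem_pmap; apply/mapP/idP => [[y yA /esym/ginvE <-] //|gA].
  by exists (g x).
clearbody A1; have := hA A1; have -> : \sum_(x <- A1) f x = \sum_(y <- A) h y.
  have -> : \sum_(x <- A1) f x = \sum_(y <- g @` A1) h y.
    rewrite big_imfset /=; last by move=> x y _ _; exact: gi.
    by apply: eq_bigr => x _; rewrite hg.
  apply: big_fset_incl => [|y yA yn].
    by apply/fsubsetP => _ /imfsetP[x /= + ->]; rewrite A1E.
  apply: h0 => x yx; move/negP: yn; apply; rewrite yx; apply/imfsetP.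
  by exists x => //=; rewrite A1E -yx.
apply; apply/fsubsetP => x xA0; rewrite A1E (fsubsetP sA) //.
by apply/imfsetP; exists x.
Qed.

End Push.

(** * Sums of powers of the norm *)

Lemma ler_sum_sub (R : realType) (T : eqType) (f : T -> R) (s t : seq T) :
  (forall x, 0 <= f x) -> uniq s -> {subset s <= t} ->
  \sum_(x <- s) f x <= \sum_(x <- t) f x.
Proof.
move=> f0; elim: s t => [|x s ih] t.
  by move=> _ _; rewrite big_nil sumr_ge0.
move=> /= /andP[xs us] st; have xt : x \in t by apply: st; rewrite mem_head.
rewrite big_cons (perm_big _ (perm_to_rem xt)) big_cons lerD2l.
apply: ih => // y ys; have yt : y \in t by apply: st; rewrite inE ys orbT.
move: yt; rewrite (perm_mem (perm_to_rem xt)) inE => /orP[/eqP yx|//].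
by move: xs; rewrite -yx ys.
Qed.

(** The discrete form of comparing x^(-1-d) with its integral. It follows from exp x >= 1 + x and
    from ln (1 + x) <= x at x = -1 / (m + 2). *)
Lemma powR_telescope (R : realType) (d : R) (m : nat) : 0 < d ->
  d * m.+2%:R `^ (- (1 + d)) <= m.+1%:R `^ (- d) - m.+2%:R `^ (- d).
Proof.
move=> d0; have n0 : (0 : R) < m.+2%:R by rewrite ltr0n.
have m0 : (0 : R) < m.+1%:R by rewrite ltr0n.
rewrite lerBrDl opprD powRD; last by apply/implyP => _; rewrite gt_eqF.
rewrite powR_inv1 ?(ltW n0) // mulrA -{1}[m.+2%:R `^ (- d)]mul1r -mulrDl.
have -> : m.+1%:R `^ (- d) = (m.+1%:R / m.+2%:R) `^ (- d) * m.+2%:R `^ (- d) :> R.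
  by rewrite -powRM ?divr_ge0 ?(ltW m0) ?(ltW n0) // divfK // gt_eqF.
rewrite ler_wpM2r ?powR_ge0 //.
have q0 : (0 : R) < m.+1%:R / m.+2%:R by rewrite divr_gt0.
rewrite /powR gt_eqF //; apply: le_trans (expR_ge1Dx _).
rewrite lerD2l mulNr -mulrN ler_pM2l // lerNr.
have -> : m.+1%:R / m.+2%:R = 1 + - m.+2%:R^-1 :> R.
  have -> : m.+1%:R = m.+2%:R - 1 :> R by rewrite -[m.+2%:R]natr1 addrK.
  by rewrite mulrBl mul1r divff // gt_eqF.
by apply: le_ln1Dx; rewrite ltrN2 invf_lt1 // ltr1n.
Qed.

Lemma sum_powR_le (R : realType) (d : R) (X : nat) : 0 < d ->
  \sum_(0 <= n < X) n.+1%:R `^ (- (1 + d)) <= 1 + d^-1.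
Proof.
move=> d0; case: X => [|X].
  by rewrite big_geq // addr_ge0 // invr_ge0 (ltW d0).
suff : \sum_(0 <= n < X.+1) n.+1%:R `^ (- (1 + d)) <=
    1 + d^-1 * (1 - X.+1%:R `^ (- d)).
  move=> h; apply: (le_trans h); by rewrite lerD2l ler_piMr ?invr_ge0 ?(ltW d0) // gerBl powR_ge0.
elim: X => [|X ih]; first by rewrite big_nat1 !powR1 subrr mulr0 addr0.
rewrite big_nat_recr //=; apply: (le_trans (lerD ih (lexx _))).
have := powR_telescope X d0; rewrite -ler_pdivlMl //.
by rewrite mulrBr mulrBr mulrBr; lra.
Qed.

Section Weight.
Variable R : realType.
Implicit Types (s : R) (z w : gauss).

Definition gwt s z : R := (gnorm z)%:R `^ (- s).

Lemma gwt_ge0 s z : 0 <= gwt s z.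
Proof. exact: powR_ge0. Qed.

Lemma gwtM s z w : gwt s (z * w) = gwt s z * gwt s w.
Proof. by rewrite /gwt gnormM natrM powRM. Qed.

Lemma gwt0 s : 0 < s -> gwt s 0 = 0.
Proof. by move=> s0; rewrite /gwt powR0 // oppr_eq0 gt_eqF. Qed.

Lemma gwt_unit s z : gnorm z = 1%N -> gwt s z = 1.
Proof. by move=> z1; rewrite /gwt z1 powR1. Qed.

Lemma gwt_le1 s z : 0 < s -> gwt s z <= 1.
Proof.
move=> s0; have [->|z0] := eqVneq z 0; first by rewrite gwt0.
have n1 : (1 : R) <= (gnorm z)%:R by rewrite ler1n gnorm_gt0.
by rewrite /gwt -[leRHS](powRr0 (gnorm z)%:R) ler_powR // oppr_le0 ltW.
Qed.

Lemma gwt_le s s' z : z != 0 -> s <= s' -> gwt s' z <= gwt s z.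
Proof.
by move=> z0 ss; rewrite /gwt ler_powR ?lerN2 // ler1n gnorm_gt0.
Qed.

(** Off the origin, (|a| + 1) (|b| + 1) <= 4 (a^2 + b^2). This dominates the planar sum by a product
    of two sums over the integers, each finite for s > 1. *)
Lemma gwt_prod s z : 0 < s -> z != 0 ->
  gwt s z <= 4 `^ s * ((`|z.1|%N).+1%:R `^ (- s) * (`|z.2|%N).+1%:R `^ (- s)).
Proof.
move=> s0 z0; rewrite -powRM // -natrM.
have n0 : (0 : R) < (gnorm z)%:R by rewrite ltr0n gnorm_gt0.
have m0 : (0 : R) < ((`|z.1|%N).+1 * (`|z.2|%N).+1)%:R by rewrite ltr0n.
rewrite /gwt !powRN ler_pdivlMr ?powR_gt0 // ler_pdivrMl ?powR_gt0 // mulrC.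
rewrite -powRM // -natrM ge0_ler_powR ?nnegrE ?(ltW s0) // ler_nat.
rewrite -lez_nat !PoszM gnormE; case: z z0 {n0 m0} => a b z0 /=.
have : a != 0 \/ b != 0.
  by apply/orP; rewrite -negb_and; apply: contra z0 => /andP[/eqP -> /eqP ->].
by have [] := leP `|a|%N `|b|%N; nia.
Qed.

Lemma gwt_bounded s : 1 < s -> exists B, abs_bounded (gwt s) B.
Proof.
move=> s1; have s0 : 0 < s by apply: lt_trans s1.
pose d := s - 1; have d0 : 0 < d by rewrite subr_gt0.
have sE : s = 1 + d by rewrite /d addrC subrK.
pose G (a : int) : R := (`|a|%N).+1%:R `^ (- s).
exists (4 `^ s * ((1 + d^-1) + (1 + d^-1)) ^+ 2) => A.
pose F z := 4 `^ s * (G z.1 * G z.2).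
apply: (@le_trans _ _ (\sum_(z <- A) F z)).
  apply: ler_sum => z _; rewrite ger0_norm ?gwt_ge0 //.
  have [->|z0] := eqVneq z 0; last exact: gwt_prod.
  by rewrite gwt0 // !mulr_ge0 ?powR_ge0.
pose X := (\max_(z <- A) maxn `|z.1| `|z.2|).+1.
(* All integers of absolute value below X; 0 occurs twice, which only enlarges the upper bound. *)
pose xs := [seq Posz n | n <- index_iota 0 X] ++ [seq - Posz n | n <- index_iota 0 X].
apply: (@le_trans _ _ (\sum_(z <- [seq (x, y) : gauss | x <- xs, y <- xs]) F z)).
  apply: ler_sum_sub => [z||z zA]; [by rewrite !mulr_ge0 ?powR_ge0|exact: fset_uniq|].
  have : (maxn `|z.1| `|z.2| < X)%N by rewrite ltnS; exact: (leq_bigmax_seq z zA).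
  rewrite gtn_max => /andP[h1 h2].
  have xsE (a : int) : (`|a| < X)%N -> a \in xs.
    move=> aX; rewrite mem_cat; apply/orP; have [a0|a0] := leP 0 a; [left|right].
      by apply/mapP; exists `|a|%N; [rewrite mem_index_iota|lia].
    by apply/mapP; exists `|a|%N; [rewrite mem_index_iota|lia].
  by apply/allpairsP; exists (z.1, z.2); rewrite /= !xsE //; case: z {zA h1 h2}.
rewrite big_allpairs /F.
under eq_bigr => x _ do rewrite /= -mulr_sumr -mulr_sumr.
rewrite -mulr_sumr -mulr_suml ler_pM2l ?powR_gt0 //.
have hxs : 0 <= \sum_(x <- xs) G x <= (1 + d^-1) + (1 + d^-1).
  rewrite sumr_ge0 => [|x _]; last exact: powR_ge0.
  rewrite big_cat !big_map /= lerD //.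
    by have := sum_powR_le X d0; rewrite -sE.
  have := sum_powR_le X d0; rewrite -sE; apply: le_trans.
  by rewrite le_eqVlt; apply/orP; left; apply/eqP; apply: eq_bigr => n _;
    rewrite /G abszN.
by case/andP: hxs => h1 h2; rewrite expr2 ler_pM.
Qed.

Lemma harmonic_unbounded (K : R) : exists X, K <= \sum_(0 <= k < X) k.+1%:R^-1.
Proof.
apply: contrapT => /forallNP h; apply: (@dvg_harmonic R).
apply: nondecreasing_is_cvgn.
  apply/nondecreasing_seqP => n; rewrite /series /= big_nat_recr //=.
  by rewrite lerDl invr_ge0.
exists K => _ [n _ <-]; rewrite /series /=.
by have /negP := h n; rewrite -ltNge => /ltW.
Qed.

(** The x + 1 points (x + 1, y) with 0 <= y <= x have norm at most 2 (x + 1)^2, so at s = 1 they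
    contribute at least 1 / (2 (x + 1)), a harmonic term. Taking s slightly above 1 costs at most a
    factor 1/e. *)
Lemma gwt_unbounded (K : R) : exists s, [/\ 1 < s, s <= 2 &
  exists A : {fset gauss}, K <= \sum_(z <- A) gwt s z].
Proof.
have e0 : (0 : R) < expR (-1) by exact: expR_gt0.
have [X hX] := harmonic_unbounded (K * 2 / expR (-1)).
(* [m] bounds every norm that occurs, so norm^(-1/m) = exp (- ln norm / m) >= 1/e. *)
pose m : nat := (2 * X.+1 ^ 2)%N; pose s : R := 1 + m%:R^-1.
have m0 : (0 : R) < m%:R by rewrite ltr0n muln_gt0 expn_gt0.
exists s; split; first by rewrite /s ltrDl invr_gt0.
  by rewrite /s -[leRHS]/(1 + 1) lerD2l invf_le1 // ler1n -(ltr0n R).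
pose rs := [seq (Posz x.+1, Posz y) : gauss | x <- iota 0 X, y <- iota 0 x.+1].
have urs : uniq rs.
  apply: allpairs_uniq_dep => [|x _|]; [exact: iota_uniq|exact: iota_uniq|].
  by move=> [x y] [x' y'] _ _ /= [-> ->].
exists [fset z in rs].
rewrite (perm_big rs) /=; last first.
  apply: uniq_perm => //; first exact: fset_uniq.
  by move=> z; rewrite !inE.
rewrite big_allpairs_dep /=.
apply: (@le_trans _ _ (\sum_(x <- iota 0 X) expR (-1) / 2 * x.+1%:R^-1)).
  rewrite -mulr_sumr mulrC -ler_pdivrMr ?divr_gt0 // invf_div mulrA.
  by move: hX; rewrite /index_iota subn0.
rewrite big_seq [leRHS]big_seq; apply: ler_sum => x; rewrite mem_iota /= => xX.
apply: (@le_trans _ _ (\sum_(y <- iota 0 x.+1) expR (-1) * (2 * x.+1%:R ^+ 2)^-1)).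
  rewrite big_const_seq count_predT size_iota iter_addr_0.
  rewrite -mulr_natr le_eqVlt; apply/orP; left; apply/eqP.
  have x0 : x.+1%:R != 0 :> R by rewrite pnatr_eq0.
  by field; rewrite addrC natr1 x0.
rewrite big_seq [leRHS]big_seq; apply: ler_sum => y; rewrite mem_iota /= => yx.
pose z : gauss := (Posz x.+1, Posz y); rewrite -/z.
have nz : (gnorm z <= 2 * x.+1 ^ 2)%N.
  by rewrite -lez_nat gnormE /= PoszM -!mulnn !PoszM; nia.
have nz0 : (0 : R) < (gnorm z)%:R by rewrite ltr0n gnorm_gt0.
have nm : (gnorm z <= m)%N.
  by apply: (leq_trans nz); rewrite leq_mul2l leq_exp2r //= ltnW // ltnS.
rewrite /gwt /s opprD powRD; last by apply/implyP => _; rewrite gt_eqF.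
rewrite powR_inv1 ?(ltW nz0) // mulrC; apply: ler_pM.
- by rewrite invr_ge0 mulr_ge0 ?exprn_ge0.
- exact: ltW.
- by rewrite lef_pV2 ?posrE ?mulr_gt0 ?exprn_gt0 // -natrX -natrM ler_nat.
rewrite /powR gt_eqF // ler_expR mulNr lerN2 ler_pdivrMl // mulr1.
by apply: (le_trans (ltW (ln_sublinear nz0))); rewrite ler_nat.
Qed.

End Weight.

(** * Hecke characters *)

Section Complex.
Variable R : realType.
Implicit Types x y : R[i].

Lemma cReD x y : Re (x + y) = Re x + Re y. Proof. by case: x y => [a b] []. Qed.
Lemma cImD x y : Im (x + y) = Im x + Im y. Proof. by case: x y => [a b] []. Qed.
Lemma cReB x y : Re (x - y) = Re x - Re y. Proof. by case: x y => [a b] []. Qed.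
Lemma cImB x y : Im (x - y) = Im x - Im y. Proof. by case: x y => [a b] []. Qed.
Lemma cReM x y : Re (x * y) = Re x * Re y - Im x * Im y.
Proof. by case: x y => [a b] []. Qed.
Lemma cImM x y : Im (x * y) = Re x * Im y + Im x * Re y.
Proof. by case: x y => [a b] []. Qed.

Lemma normcE' x : normc x = Num.sqrt (Re x ^+ 2 + Im x ^+ 2).
Proof. by case: x. Qed.

Lemma normc_sqr x : normc x ^+ 2 = Re x ^+ 2 + Im x ^+ 2.
Proof. by rewrite normcE' sqr_sqrtr // addr_ge0 // sqr_ge0. Qed.

Lemma normc_ge0 x : 0 <= normc x.
Proof. by rewrite normcE' sqrtr_ge0. Qed.

Lemma normcD x y : normc (x + y) <= normc x + normc y.
Proof. exact: le_normcD. Qed.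

Lemma normc_opp x : normc (- x) = normc x.
Proof. exact: normcN. Qed.

Lemma normcBC x y : normc (x - y) = normc (y - x).
Proof. by rewrite -normc_opp opprB. Qed.

Lemma normcB_ge x y : normc x - normc y <= normc (x - y).
Proof. by rewrite lerBlDr (le_trans _ (normcD _ _)) // subrK. Qed.

Lemma normcX x n : normc (x ^+ n) = normc x ^+ n.
Proof. by elim: n => [|n ih]; rewrite ?normc1 // !exprS normcM ih. Qed.

Lemma normcR (a : R) : normc a%:C = `|a|.
Proof. by rewrite normcE' /= expr0n addr0 sqrtr_sqr. Qed.

Lemma normc_Re x : `|Re x| <= normc x.
Proof.
by rewrite normcE' -sqrtr_sqr ler_sqrt ?addr_ge0 ?sqr_ge0 // lerDl sqr_ge0.
Qed.

Lemma normc_Im x : `|Im x| <= normc x.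
Proof.
by rewrite normcE' -sqrtr_sqr ler_sqrt ?addr_ge0 ?sqr_ge0 // lerDr sqr_ge0.
Qed.

Lemma normc_le x : normc x <= `|Re x| + `|Im x|.
Proof.
case: x => a b; have -> : a +i* b = a%:C + 'i * b%:C :> R[i] by simpc.
rewrite (le_trans (normcD _ _)) // normcM !normcR.
have -> : normc 'i = 1 :> R by rewrite normcE' /= expr0n add0r expr1n sqrtr1.
by rewrite mul1r; simpc.
Qed.

Lemma subX_normc x y n : normc x <= 1 -> normc y <= 1 ->
  normc (x ^+ n - y ^+ n) <= n%:R * normc (x - y).
Proof.
move=> x1 y1; elim: n => [|n ih]; first by rewrite subrr normc0 mul0r.
have -> : x ^+ n.+1 - y ^+ n.+1 = x * (x ^+ n - y ^+ n) + (x - y) * y ^+ n.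
  by rewrite !exprS; ring.
rewrite (le_trans (normcD _ _)) // !normcM -natr1 mulrDl mul1r lerD //.
  by apply: (le_trans _ ih); rewrite ler_piMl ?normc_ge0.
by rewrite ler_piMr ?normc_ge0 // normcX exprn_ile1 ?normc_ge0.
Qed.

Lemma normc_prod (I : Type) (r : seq I) (F : I -> R[i]) :
  normc (\prod_(i <- r) F i) = \prod_(i <- r) normc (F i).
Proof. exact: (big_morph (@normc R) (@normcM R) (normc1 R)). Qed.

End Complex.

Section Csum.
Variables (R : realType).
Implicit Types (T U : choiceType) (L : R[i]).

Definition csum T (f : T -> R[i]) L :=
  has_sum (fun x => Re (f x)) (Re L) /\ has_sum (fun x => Im (f x)) (Im L).

Lemma csum_ext T (f g : T -> R[i]) L : f =1 g -> csum f L -> csum g L.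
Proof.
by move=> fg [h1 h2]; split; [apply: has_sum_ext h1|apply: has_sum_ext h2] => x;
  rewrite fg.
Qed.

Lemma csum_uniq T (f : T -> R[i]) L L' : csum f L -> csum f L' -> L = L'.
Proof.
move=> [a b] [a' b']; case: L L' a b a' b' => [u v] [u' v'] /= a b a' b'.
by rewrite (has_sum_uniq a a') (has_sum_uniq b b').
Qed.

Lemma csumB T (f g : T -> R[i]) L L' : csum f L -> csum g L' ->
  csum (fun x => f x - g x) (L - L').
Proof.
move=> [a b] [a' b']; split.
  by rewrite cReB; apply: has_sum_ext (has_sumB a a') => x; rewrite cReB.
by rewrite cImB; apply: has_sum_ext (has_sumB b b') => x; rewrite cImB.
Qed.

Lemma csumZ T (f : T -> R[i]) L c : csum f L -> csum (fun x => c * f x) (c * L).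
Proof.
move=> [a b]; split.
  rewrite cReM; apply: has_sum_ext (has_sumB (has_sumZ (Re c) a) (has_sumZ (Im c) b)) => x.
  by rewrite cReM.
rewrite cImM; apply: has_sum_ext (has_sumD (has_sumZ (Re c) b) (has_sumZ (Im c) a)) => x.
by rewrite cImM.
Qed.

Lemma csum_push T U (g : T -> U) (f : T -> R[i]) (h : U -> R[i]) L :
  injective g -> (forall x, h (g x) = f x) ->
  (forall y, (forall x, y <> g x) -> h y = 0) ->
  csum f L -> csum h L.
Proof.
move=> gi hg h0 [a b]; split.
  by apply: (has_sum_push gi _ _ a) => [x|y /h0 ->//]; rewrite hg.
by apply: (has_sum_push gi _ _ b) => [x|y /h0 ->//]; rewrite hg.
Qed.

Lemma csum_sum T (I : Type) (r : seq I) (F : I -> T -> R[i]) (L : I -> R[i]) :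
  (forall i, csum (F i) (L i)) ->
  csum (fun x => \sum_(i <- r) F i x) (\sum_(i <- r) L i).
Proof.
move=> h; have ReS (G : I -> R[i]) : Re (\sum_(i <- r) G i) = \sum_(i <- r) Re (G i).
  by apply: (big_morph _ (@cReD R)).
have ImS (G : I -> R[i]) : Im (\sum_(i <- r) G i) = \sum_(i <- r) Im (G i).
  by apply: (big_morph _ (@cImD R)).
split; [rewrite ReS|rewrite ImS].
  by apply: has_sum_ext (has_sum_sum r (fun i => (h i).1)) => x; rewrite ReS.
by apply: has_sum_ext (has_sum_sum r (fun i => (h i).2)) => x; rewrite ImS.
Qed.

Lemma abs_bounded_Re T (f : T -> R[i]) (g : T -> R) B :
  (forall x, normc (f x) <= g x) -> abs_bounded g B ->
  abs_bounded (fun x => Re (f x)) B.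
Proof.
move=> fg hB A; apply: le_trans (hB A); apply: ler_sum => x _.
by apply: (le_trans (normc_Re _)); apply: (le_trans (fg x)); exact: ler_norm.
Qed.

Lemma abs_bounded_Im T (f : T -> R[i]) (g : T -> R) B :
  (forall x, normc (f x) <= g x) -> abs_bounded g B ->
  abs_bounded (fun x => Im (f x)) B.
Proof.
move=> fg hB A; apply: le_trans (hB A); apply: ler_sum => x _.
by apply: (le_trans (normc_Im _)); apply: (le_trans (fg x)); exact: ler_norm.
Qed.

Lemma csum_ex T (f : T -> R[i]) (g : T -> R) B :
  (forall x, normc (f x) <= g x) -> abs_bounded g B -> exists L, csum f L.
Proof.
move=> fg hB.
have [a ha] := has_sum_ex (abs_bounded_Re fg hB).
have [b hb] := has_sum_ex (abs_bounded_Im fg hB).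
by exists (a +i* b).
Qed.

Lemma csum_le T (f : T -> R[i]) (g : T -> R) B L :
  (forall x, normc (f x) <= g x) -> abs_bounded g B -> csum f L ->
  normc L <= B *+ 2.
Proof.
move=> fg hB [a b]; apply: (le_trans (normc_le _)); rewrite mulr2n lerD //.
  exact: (has_sum_le a (abs_bounded_Re fg hB)).
exact: (has_sum_le b (abs_bounded_Im fg hB)).
Qed.

End Csum.

Section Character.
Variable R : realType.
Implicit Types (z w : gauss) (s : R).

Definition emb z : R[i] := z.1%:~R +i* z.2%:~R.

(* Junk value: [dir 0 = 0], so [chr k s 0 = 0] for [s > 0]. *)
Definition dir z : R[i] := emb z / (Num.sqrt (gnorm z)%:R)%:C.

(* The term at [z] of the Hecke L-series of frequency [4k]; the factor 4 makes
   it invariant under units. *)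
Definition chr (k : nat) s z : R[i] := dir z ^+ (4 * k) * (gwt s z)%:C.

Lemma embM z w : emb (z * w) = emb z * emb w.
Proof. by rewrite gmulE /emb /=; simpc; rewrite !rmorphB !rmorphD !rmorphM. Qed.

Lemma embB z w : emb (z - w) = emb z - emb w.
Proof. by rewrite /emb /=; simpc; rewrite !rmorphB. Qed.

Lemma emb0 : emb 0 = 0. Proof. by []. Qed.

Lemma normc_emb z : normc (emb z) = Num.sqrt (gnorm z)%:R.
Proof.
by rewrite normcE' /= -!rmorphXn -rmorphD /= -gnormE.
Qed.

Lemma dirM z w : dir (z * w) = dir z * dir w.
Proof.
by rewrite /dir embM gnormM natrM sqrtrM // rmorphM /= invfM mulrACA.
Qed.

Lemma dir0 : dir 0 = 0.
Proof. by rewrite /dir emb0 mul0r. Qed.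

Lemma sqrt_gnorm_gt0 z : z != 0 -> 0 < Num.sqrt (gnorm z)%:R :> R.
Proof. by move=> z0; rewrite sqrtr_gt0 ltr0n gnorm_gt0. Qed.

Lemma normc_dir z : z != 0 -> normc (dir z) = 1.
Proof.
move=> z0; rewrite /dir normcM normcV normc_emb normcR ger0_norm ?sqrtr_ge0 //.
by rewrite divff // gt_eqF // sqrt_gnorm_gt0.
Qed.

Lemma normc_dir_le1 z : normc (dir z) <= 1.
Proof.
by have [->|/normc_dir ->//] := eqVneq z 0; rewrite dir0 normc0.
Qed.

Lemma chrM k s z w : chr k s (z * w) = chr k s z * chr k s w.
Proof. by rewrite /chr dirM gwtM exprMn rmorphM mulrACA. Qed.

Lemma chr0 k s : 0 < s -> chr k s 0 = 0.
Proof. by move=> s0; rewrite /chr gwt0 // mulr0. Qed.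

Lemma normc_chr k s z : 0 < s -> normc (chr k s z) = gwt s z.
Proof.
move=> s0; have [->|z0] := eqVneq z 0; first by rewrite chr0 // gwt0 // normc0.
by rewrite /chr normcM normcX normc_dir // expr1n mul1r normcR ger0_norm ?gwt_ge0.
Qed.

Lemma dir_unit z : gnorm z = 1%N -> dir z ^+ 4 = 1.
Proof.
move=> z1; rewrite /dir z1 sqrtr1 invr1 mulr1.
case: (gunitP z1) => ->; rewrite /emb /= !exprS expr0 mulr1; simpc; 
by congr (_ +i* _); ring.
Qed.

Lemma chr_unit k s z : gnorm z = 1%N -> chr k s z = 1.
Proof. by move=> z1; rewrite /chr exprM dir_unit // expr1n gwt_unit // mulr1. Qed.

Lemma csum_chr_ex k s : 1 < s -> exists L, csum (chr k s) L.
Proof.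
move=> s1; have s0 : 0 < s by apply: lt_trans s1.
have [B hB] := gwt_bounded s1; apply: (csum_ex _ hB) => x.
by rewrite normc_chr.
Qed.

End Character.

(** * Boundedness of the Hecke L-series as s tends to 1 *)

Section Cancellation.
Variable R : realType.
Implicit Types (z w : gauss) (s : R).

(** With q = n / m, the difference is n^(-s) (1 - q^s), and 1 - q^s <= 1 - q^2 <= 2 (1 - q) since s
    <= 2. *)
Lemma powR_diff (n m s : R) : 1 <= n -> n <= m -> 1 <= s -> s <= 2 ->
  `|n `^ (- s) - m `^ (- s)| <= 2 * n^-1 * ((m - n) / m).
Proof.
move=> n1 nm s1 s2.
have n0 : 0 < n by apply: lt_le_trans n1.
have m0 : 0 < m by apply: lt_le_trans nm.
have q0 : 0 < n / m by rewrite divr_gt0.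
have q1 : n / m <= 1 by rewrite ler_pdivrMr // mul1r.
have mE : m `^ (- s) = n `^ (- s) * (n / m) `^ s.
  rewrite powRM ?invr_ge0 ?(ltW n0) ?(ltW m0) // mulrA -powRD; last first.
    by apply/implyP => _; rewrite gt_eqF.
  rewrite addNr powRr0 mul1r -[in RHS]powR_inv1 ?(ltW m0) //.
  by rewrite -powRrM mulN1r.
rewrite mE -[X in X - _]mulr1 -mulrBr normrM (ger0_norm (powR_ge0 _ _)).
have h1 : n `^ (- s) <= n^-1.
  by rewrite -powR_inv1 ?(ltW n0) // ler_powR // lerN2.
have h2 : (n / m) ^+ 2 <= (n / m) `^ s.
  by rewrite -powR_mulrn ?(ltW q0) // ger_powR // q0.
have h3 : (n / m) `^ s <= 1.
  by rewrite -(powRr0 (n / m)) ger_powR ?q0 // (le_trans _ s1).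
rewrite [2 * _]mulrC -mulrA ler_pM ?powR_ge0 //.
rewrite ger0_norm ?subr_ge0 // mulrBl divff ?gt_eqF //.
by move: h2; move: (n / m) q0 q1 => q q0 q1; rewrite expr2; nra.
Qed.

(** Write z/|z| - w/|w| as (z - w)/|z| + w (1/|z| - 1/|w|); each term is at most |z - w|/|z|. *)
Lemma dir_diff (z w : gauss) : z != 0 -> w != 0 ->
  normc (dir R z - dir R w) <= 2 * normc (emb R z - emb R w) / normc (emb R z).
Proof.
move=> z0 w0; rewrite /dir -!normc_emb.
have r0 : 0 < normc (emb R z) by rewrite normc_emb sqrt_gnorm_gt0.
have t0 : 0 < normc (emb R w) by rewrite normc_emb sqrt_gnorm_gt0.
have h := normcB_ge (emb R z) (emb R w).
have h' := normcB_ge (emb R w) (emb R z); rewrite normcBC in h'.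
have tW := erefl (normc (emb R w)); move: {2}(normc (emb R w)) tW => t tW.
have rW := erefl (normc (emb R z)); move: {2}(normc (emb R z)) rW => r rW.
rewrite rW tW in r0 t0 h h' *.
have -> : emb R z / r%:C - emb R w / t%:C =
  (emb R z - emb R w) / r%:C + emb R w * (r^-1 - t^-1)%:C.
  by rewrite rmorphB /= !fmorphV /=; ring.
apply: (le_trans (normcD _ _)); rewrite !normcM normcV !normcR tW.
rewrite (gtr0_norm r0) -[leRHS]mulrA mulr_natl mulr2n lerD //.
have -> : r^-1 - t^-1 = (t - r) / (t * r).
  by field; rewrite !gt_eqF.
rewrite normrM normfV (gtr0_norm (mulr_gt0 t0 r0)).
have -> : t * (`|t - r| / (t * r)) = `|t - r| / r by field; rewrite !gt_eqF.
by rewrite ler_wpM2r ?invr_ge0 ?(ltW r0) // ler_norml lerNl opprB h h'.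
Qed.

(** The error terms below are of size |z|^(-3), one power of |z| better than the terms of the series
    at s = 1. Exponent 3/2 is above 1, so they are summable by [gwt_bounded], uniformly in s. *)
Lemma gwt_half z : gwt (3 / 2 : R) z = (normc (emb R z))^-1 ^+ 3.
Proof.
rewrite normc_emb /gwt -mulNr mulrC powRrM -powR12_sqrt //.
by rewrite -[- 3]/(- 3%:R) powR_invn ?powR_ge0 // exprVn.
Qed.

Lemma gwt_le_inv2 s z : 1 <= s -> z != 0 -> gwt s z <= (normc (emb R z))^-1 ^+ 2.
Proof.
move=> s1 z0; apply: (le_trans (gwt_le z0 s1)).
by rewrite /gwt powR_inv1 // exprVn normc_emb sqr_sqrtr.
Qed.

Lemma normc_emb_ge1 z : z != 0 -> 1 <= normc (emb R z).
Proof. by move=> z0; rewrite normc_emb -[leLHS]sqrtr1 ler_wsqrtr // ler1n gnorm_gt0. Qed.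

Lemma normc_emb_sqr z : normc (emb R z) ^+ 2 = (gnorm z)%:R.
Proof. by rewrite normc_emb sqr_sqrtr. Qed.

Lemma gwt_diff s z w : 1 <= s -> s <= 2 -> z != 0 -> w != 0 ->
  normc (emb R z - emb R w) <= 4 ->
  `|gwt s z - gwt s w| <= 2000 * (normc (emb R z))^-1 ^+ 3.
Proof.
move=> s1 s2 z0 w0 d4.
(* The constant is 16 when measured at the point of smaller norm. If that point is w, then |z| <=
   |w| + 4 <= 5 |w|, and 16 * 5^3 = 2000. *)
suff H (x y : gauss) : x != 0 -> y != 0 -> normc (emb R x - emb R y) <= 4 ->
    (gnorm x <= gnorm y)%N ->
    `|gwt s x - gwt s y| <= 16 * (normc (emb R x))^-1 ^+ 3.
  have h := normcB_ge (emb R z) (emb R w).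
  have r1 := normc_emb_ge1 z0; have t1 := normc_emb_ge1 w0.
  have [le|/ltnW le] := leqP (gnorm z) (gnorm w).
    apply: (le_trans (H _ _ z0 w0 d4 le)); apply: ler_wpM2r; last by lra.
    by rewrite exprn_ge0 // invr_ge0 (le_trans ler01 r1).
  rewrite -normrN opprB; rewrite normcBC in d4.
  apply: (le_trans (H _ _ w0 z0 d4 le)); rewrite normcBC in d4.
  have {h d4} : normc (emb R z) <= 5 * normc (emb R w) by lra.
  move: (normc (emb R z)) (normc (emb R w)) r1 t1 => r t r1 t1 rt.
  have r0 : 0 < r by apply: lt_le_trans r1.
  have t0 : 0 < t by apply: lt_le_trans t1.
  have : t^-1 <= 5 * r^-1 by rewrite ler_pdivlMr // mulrC ler_pdivrMr.
  move=> h; have : t^-1 ^+ 3 <= (5 * r^-1) ^+ 3.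
    by rewrite lerXn2r // nnegrE ?invr_ge0 ?mulr_ge0 ?invr_ge0 ?(ltW r0) ?(ltW t0).
  by rewrite exprMn; lra.
move: x y => {z0 w0 d4}z {}w z0 w0 d4 le; have r1 := normc_emb_ge1 z0; have t1 := normc_emb_ge1 w0.
have := normcB_ge (emb R w) (emb R z); rewrite normcBC => h.
have {h} h := le_trans h d4.
have n1 : 1 <= (gnorm z)%:R :> R by rewrite ler1n gnorm_gt0.
have nm : (gnorm z)%:R <= (gnorm w)%:R :> R by rewrite ler_nat.
apply: (le_trans (powR_diff n1 nm s1 s2)).
rewrite -!normc_emb_sqr.
have rt : normc (emb R z) <= normc (emb R w).
  by rewrite !normc_emb ler_wsqrtr // ler_nat.
move: (normc (emb R z)) (normc (emb R w)) r1 t1 rt h => r t r1 t1 rt h.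
have r0 : 0 < r by apply: lt_le_trans r1.
have t0 : 0 < t by apply: lt_le_trans t1.
have -> : (16 : R) * r^-1 ^+ 3 = 2 * (r ^+ 2)^-1 * (8 * r^-1).
  by field; rewrite gt_eqF.
rewrite ler_wpM2l ?mulr_ge0 ?invr_ge0 ?exprn_ge0 ?(ltW r0) //.
rewrite ler_pdivrMr ?exprn_gt0 //.
have h1 : t ^+ 2 - r ^+ 2 <= 8 * t by rewrite !expr2; nra.
apply: (le_trans h1); rewrite -mulrA ler_pM2l // ler_pdivlMl //.
by rewrite expr2 ler_pM2r.
Qed.

(** The factor 32 k is 4 k from the power of [dir], 2 from [dir_diff] and 4 from the distance; 2000
    comes from [gwt_diff]. Distance 4 suits the representatives 0, ..., 4 of the residue classes
    modulo 2 + i. *)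
Lemma chr_diff k s z w : 1 <= s -> s <= 2 -> z != 0 -> w != 0 ->
  normc (emb R z - emb R w) <= 4 ->
  normc (chr k s z - chr k s w) <= (32 * k%:R + 2000) * gwt (3 / 2 : R) z.
Proof.
move=> s1 s2 z0 w0 d4; rewrite gwt_half /chr.
set a := dir R z ^+ _; set b := dir R w ^+ _.
have -> : a * (gwt s z)%:C - b * (gwt s w)%:C =
   (a - b) * (gwt s z)%:C + b * (gwt s z - gwt s w)%:C.
  by rewrite rmorphB /=; ring.
apply: (le_trans (normcD _ _)); rewrite [leRHS]mulrDl lerD //.
  rewrite normcM normcR ger0_norm ?gwt_ge0 // exprS mulrA ler_pM ?normc_ge0 ?gwt_ge0 //.
    apply: (le_trans (subX_normc _ (normc_dir_le1 _ _) (normc_dir_le1 _ _))).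
    have -> : 32 * k%:R / normc (emb R z) = (4 * k)%:R * (8 / normc (emb R z)) :> R.
      by rewrite natrM; ring.
    rewrite ler_wpM2l //; apply: (le_trans (dir_diff z0 w0)).
    rewrite ler_wpM2r ?invr_ge0 ?normc_ge0 //; lra.
  exact: gwt_le_inv2.
rewrite normcM normcR /b normcX normc_dir // expr1n mul1r.
exact: gwt_diff.
Qed.

End Cancellation.

Lemma abs_bounded_comp (R : realType) (T U : choiceType) (g : T -> U)
  (f : U -> R) (B : R) : injective g -> abs_bounded f B ->
  abs_bounded (fun x => f (g x)) B.
Proof.
move=> gi hB A; apply: le_trans (hB (g @` A)).
by rewrite big_imfset //= => x y _ _; exact: gi.
Qed.

Lemma sum_delta_ge0 (R : realType) (T : choiceType) (t : T) (A : {fset T}) :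
  \sum_(x <- A) (x == t)%:R <= 1 :> R.
Proof.
have [tA|tA] := boolP (t \in A).
  rewrite (big_fsetD1 t) //= eqxx big_seq big1 ?addr0 // => x.
  by rewrite !inE => /andP[/negPf -> _].
rewrite big_seq big1 // => x xA; case: eqP => // xt.
by rewrite -xt xA in tA.
Qed.

Section Cancellation.
Variable R : realType.
Implicit Types (z w : gauss) (s : R).

Let w0 : gauss := (2, 1).

(* Modulo 5, the powers of [2 + i] alternate between [2 + i] and [3 + 4i]. *)
Lemma expw0_not_real n :
  exists t : int, (w0 ^+ n.+1).1 = 2 * (w0 ^+ n.+1).2 + 5 * t /\
    ~~ (5 %| (w0 ^+ n.+1).2)%Z.
Proof.
elim: n => [|n [t [h1 h2]]]; first by exists 0; rewrite expr1.
rewrite exprS gmulE /=; move: (w0 ^+ n.+1) h1 h2 => [a b] /= -> h2.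
by exists (-b); split; [ring|lia].
Qed.

Lemma Im_dirw0 k : (0 < k)%N -> Im (dir R w0 ^+ (4 * k)) != 0.
Proof.
move=> k0; have [n nE] : exists n, (4 * k)%N = n.+1 by exists (4 * k).-1; lia.
have embX m z : emb R (z ^+ m) = emb R z ^+ m.
  by elim: m => [|m ih]; rewrite ?expr0 // !exprS embM ih.
rewrite nE /dir expr_div_n -embX -rmorphXn -fmorphV cImM /=.
have [t [_ h]] := expw0_not_real n.
rewrite mulr0 add0r mulf_neq0 //.
  by rewrite intr_eq0; apply: contra h => /eqP ->.
by rewrite invr_neq0 // expf_neq0 // gt_eqF // sqrtr_gt0 ltr0n.
Qed.

(** The isomorphism of Z[i]/(2 + i) with Z/5 that sends i to -2. *)
Definition residue z : int := ((z.1 - 2 * z.2) %% 5)%Z.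

Lemma residue_w0 z (c : 'I_5) : residue (w0 * z + (c%:Z, 0)) = c.
Proof.
rewrite /residue gmulE gaddE /=.
have -> : 2 * z.1 - 1 * z.2 + c%:Z - 2 * (2 * z.2 + 1 * z.1 + 0) = (- z.2) * 5 + (nat_of_ord c)%:Z by ring.
by rewrite modzMDl modz_small //= ltz_nat ltn_ord.
Qed.

Lemma residue_ex z (c : 'I_5) : residue z = c -> exists z', z = w0 * z' + (c%:Z, 0).
Proof.
rewrite /residue => h; have := divz_eq (z.1 - 2 * z.2) 5; rewrite h.
move: (_ %/ _)%Z => t e; exists (z.2 + 2 * t, - t).
rewrite gmulE gaddE /=; case: z e {h} => a b /= e; congr pair; last by ring.
have -> : a = t * 5 + (nat_of_ord c)%:Z + 2 * b by rewrite -e; ring.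
ring.
Qed.

(* Since [chr] varies slowly, each residue class modulo [w0 = 2 + i] contributes
   as much as the multiples of [w0], up to a bounded error; hence
   [L = 5 * chr w0 * L + O(1)], and [chr w0] is not real. *)
Lemma chr_sum_bounded k : (0 < k)%N -> exists C : R, forall s L,
  1 < s -> s <= 2 -> csum (chr k s) L -> normc L <= C.
Proof.
move=> k0; have [B hB] : exists B, abs_bounded (@gwt R (3 / 2)) B.
  by apply: gwt_bounded; lra.
pose K : R := 32 * k%:R + 2000; have KE : K = 32 * k%:R + 2000 by [].
have K0 : 0 <= K by rewrite /K; have := ler0n R k; lra.
clearbody K.
set lam := dir R w0 ^+ (4 * k).
have lam0 : 0 < `|Im lam| by rewrite normr_gt0 Im_dirw0.
(* Five classes with an error 2 (K B + 1) each give 10 (K B + 1). On the other side |1 - 5 [F w0]|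
   is at least 5 * 5^(-s) |Im lam|, hence at least |Im lam| / 5 as s <= 2. *)
exists (50 * (K * B + 1) / `|Im lam|) => s L s1 s2 hL.
have s0 : 0 < s by apply: lt_trans s1.
pose F z := chr k s z.
pose sh (c : 'I_5) z : gauss := w0 * z + (c%:Z, 0).
have shI c : injective (sh c) by move=> x y /addIr/gmulI; apply.
have hex c : exists lc, csum (fun z => F (sh c z)) lc.
  have [B1 hB1] := gwt_bounded s1.
  apply: (csum_ex _ (abs_bounded_comp (@shI c) hB1)) => z.
  by rewrite normc_chr.
have [l hl] := choice hex.
pose G (c : 'I_5) z := if residue z == c then F z else 0.
have hG c : csum (G c) (l c).
  apply: (csum_push (@shI c) _ _ (hl c)) => [z|z nz].
    by rewrite /G residue_w0 eqxx.
  by rewrite /G; case: eqP => // /residue_ex[z' /nz].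
have LE : L = \sum_(c < 5) l c.
  apply: (csum_uniq hL); apply: csum_ext (csum_sum _ hG) => z.
  rewrite /G -big_mkcond /=.
  have rz : 0 <= residue z < 5 by rewrite modz_ge0 //= ltz_pmod.
  have jP : (absz (residue z) < 5)%N by lia.
  rewrite (big_pred1 (Ordinal jP)) // => i /=.
  by rewrite -(inj_eq val_inj) /= -eqz_nat gez0_abs ?(andP rz).1 // eq_sym.
(* [chr_diff] says nothing at z = 0. There the difference is the single term [chr k s] at c, of
   absolute value at most 1, which the delta function accounts for. *)
pose g z : R := K * gwt (3 / 2) z + (z == 0)%:R.
have hg : abs_bounded g (K * B + 1).
  move=> A; apply: (@le_trans _ _ (\sum_(z <- A) g z)).
    apply: ler_sum => z _; rewrite ger0_norm // /g addr_ge0 // mulr_ge0 //.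
    exact: gwt_ge0.
  rewrite big_split /= lerD ?sum_delta_ge0 // -mulr_sumr ler_wpM2l //.
  by apply: le_trans (hB A); apply: ler_sum => z _; exact: ler_norm.
have hd c : normc (l c - F w0 * L) <= (K * B + 1) *+ 2.
  apply: (csum_le _ hg (csumB (hl c) (csumZ (F w0) hL))) => z.
  rewrite -[chr k s z]/(F z).
  have [->|z0] := eqVneq z 0.
    have -> : F 0 = 0 by exact: chr0.
    rewrite mulr0 subr0 normc_chr // /g eqxx gwt0; last by lra.
    rewrite mulr0 add0r.
    exact: gwt_le1.
  have wz0 : w0 * z != 0 by rewrite gmul_eq0 negb_or z0.
  rewrite /g (negPf z0) addr0 normcBC -chrM.
  have sh0 : sh c z != 0.
    apply: contra z0 => /eqP shz; have := residue_w0 z c; rewrite -/(sh c z) shz.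
    rewrite /residue mod0z => c0; move/eqP: shz; rewrite /sh -c0 addr0 gmul_eq0.
    by case/orP.
  apply: (le_trans (chr_diff _ (ltW s1) s2 wz0 sh0 _)); rewrite -?KE.
    rewrite -embB (_ : _ - _ = - ((c%:Z, 0) : gauss)); last first.
      by rewrite /sh opprD addrA subrr add0r.
    rewrite normc_emb gnormN (_ : gnorm _ = (c ^ 2)%N); last first.
      by apply/eqP; rewrite -eqz_nat gnormE /= expr0n addr0 -mulnn PoszM.
    by rewrite natrX sqrtr_sqr ger0_norm // ler_nat -ltnS ltn_ord.
  by rewrite gwtM ler_wpM2l // ler_piMl ?gwt_ge0 // gwt_le1 //; lra.
have hsum : normc (L - 5 * (F w0 * L)) <= 10 * (K * B + 1).
  have -> : L - 5 * (F w0 * L) = \sum_(c < 5) (l c - F w0 * L).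
    by rewrite sumrB -LE sumr_const card_ord mulr_natl.
  apply: (@le_trans _ _ (\sum_(c < 5) (K * B + 1) *+ 2)).
    apply: (le_trans _ (ler_sum _ (fun c _ => hd c))).
    apply: (big_ind2 (fun x y => normc x <= y)) => //.
      by rewrite normc0.
    by move=> x1 x2 y1 y2 h1 h2; apply: (le_trans (normcD _ _)); exact: lerD.
  by rewrite sumr_const card_ord -mulrnA mulr_natl.
rewrite ler_pdivlMr //.
have -> : 50 * (K * B + 1) = 5 * (10 * (K * B + 1)) by ring.
apply: (@le_trans _ _ (5 * normc (L - 5 * (F w0 * L)))); last by rewrite ler_pM2l.
have -> : L - 5 * (F w0 * L) = L * (1 - 5 * F w0) by ring.
rewrite normcM mulrCA ler_wpM2l ?normc_ge0 //.
apply: (@le_trans _ _ (5 * `|Im (1 - 5 * F w0)|)); last first.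
  by rewrite ler_pM2l // normc_Im.
have -> : 1 - 5 * F w0 = 1 - lam * (5 * gwt s w0)%:C.
  by rewrite /F /chr -/lam rmorphM /= rmorph_nat; ring.
rewrite cImB cImM /= mulr0 !add0r normrN normrM mulrCA ler_peMr //.
have w5 : gwt s w0 >= 5 ^- 2.
  rewrite /gwt -powR_invn // ler_powR ?lerN2 // ler1n //.
rewrite ger0_norm ?mulr_ge0 ?gwt_ge0 //; lra.
Qed.

End Cancellation.

(** * Sieving out the Gaussian primes *)

Definition coprime_to (P : seq gauss) (z : gauss) :=
  all (fun p => ~~ `[< gdvd p z >]) P.

Definition prime_list (P : seq gauss) :=
  uniq P /\ forall p, p \in P -> gprime p /\ quad1 p.

(* Every prime is associated to exactly one prime satisfying [quad1]. *)
Definition complete_up_to (y : nat) (P : seq gauss) :=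
  prime_list P /\
  forall p, gprime p -> quad1 p -> (gnorm p <= y)%N -> p \in P.

Lemma complete_up_to_le y y' P : (y <= y')%N -> complete_up_to y' P ->
  complete_up_to y P.
Proof. by move=> yy [h1 h2]; split=> // p h3 h4 h5; apply: h2 => //; exact: leq_trans yy. Qed.

Lemma complete_up_to_ex y : exists P, complete_up_to y P.
Proof.
exists [seq z <- undup (flatten [seq lattice_seq n | n <- iota 0 y.+1])
  | `[< gprime z >] && quad1 z]; split; first split.
- by rewrite filter_uniq // undup_uniq.
- by move=> p; rewrite mem_filter => /andP[/andP[/asboolP]].
move=> p pp qp py; rewrite mem_filter qp andbT; apply/andP; split; first exact/asboolP.
rewrite mem_undup; apply/flattenP; exists (lattice_seq (gnorm p)).
  by apply/mapP; exists (gnorm p) => //; rewrite mem_iota add0n ltnS.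
by apply/mem_lattice_seq; rewrite /lattice_points /= gnormE.
Qed.

(** A non-unit has a prime divisor, and the associate of that divisor in the fundamental quadrant
    would lie in [P] if its norm were at most y. *)
Lemma coprime_to_small y P z : complete_up_to y P -> z != 0 -> coprime_to P z ->
  gnorm z = 1%N \/ (y < gnorm z)%N.
Proof.
move=> [[_ hP] hy] z0 /allP cz; have [z1|z1] := leqP (gnorm z) 1.
  by left; apply/eqP; rewrite eqn_leq z1 gnorm_gt0.
right; rewrite ltnNge; apply/negP => zy.
have [p pp pz] := gprime_ex z1.
have [v v1 qv] := quad1_assoc (gprime_neq0 pp).
have vz : gdvd (v * p) z.
  case: pz => q ->; exists (gconj v * q).
  by rewrite mulrACA gmul_conj v1 mul1r.
have pvp : gprime (v * p).
  split; first by rewrite gnormM v1 mul1n; case: pp.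
  move=> a b e; have : p = (gconj v * a) * b.
    by rewrite -mulrA -e mulrA [gconj v * v]mulrC gmul_conj v1 mul1r.
  by move=> /pp.2; rewrite gnormM gnorm_conj v1 mul1n.
have /cz/asboolPn[] // : v * p \in P.
apply: hy => //; apply: leq_trans zy; apply: dvdn_leq (gdvd_norm vz).
exact: ltnW.
Qed.

Section Sieve.
Variable R : realType.
Implicit Types (s : R) (P : seq gauss).

Definition sieved (f : gauss -> R[i]) P z := if coprime_to P z then f z else 0.

(** The multiples of p coprime to [P] are the p z with z coprime to [P], because no prime of [P] is
    an associate of p. By multiplicativity they sum to [chr k s p * L], which is subtracted. *)
Lemma sieve_step k s L p P : 0 < s -> prime_list (p :: P) ->
  csum (sieved (chr k s) P) L ->
  csum (sieved (chr k s) (p :: P)) (L * (1 - chr k s p)).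
Proof.
move=> s0 [/= /andP[pP uP] hP] hL.
have [pp qp] := hP p (mem_head _ _).
have p0 := gprime_neq0 pp.
pose h z := if `[< gdvd p z >] && coprime_to P z then chr k s z else 0.
have cP z : coprime_to P (p * z) = coprime_to P z.
  apply: eq_in_all => q qP; have [pq qq] : gprime q /\ quad1 q by apply: hP; rewrite inE qP orbT.
  congr (~~ _); apply: asbool_equiv_eq; split; last exact: gdvd_mull.
  move=> /(gprime_dvdM pq)[/(quad1_dvd qq qp pq pp) qpE|//].
  by move: pP; rewrite -qpE qP.
have hh : csum h (chr k s p * L).
  apply: (csum_push (gmulI p0) _ _ (csumZ (chr k s p) hL)) => [z|z nz].
    rewrite /h cP asboolT; last by apply: gdvd_mulr; exact: gdvdxx.
    by rewrite /sieved /=; case: ifP => _; rewrite ?mulr0 // chrM.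
  by rewrite /h asboolF // => -[q /nz].
rewrite mulrBr mulr1 [L * _]mulrC; apply: csum_ext (csumB hL hh) => z.
rewrite /sieved /h /=; case: (coprime_to P z); rewrite ?andbF ?subrr //= andbT.
by case: asboolP => _; rewrite /= ?subrr ?subr0.
Qed.

Lemma sieve k s L P : 0 < s -> prime_list P -> csum (chr k s) L ->
  csum (sieved (chr k s) P) (L * \prod_(p <- P) (1 - chr k s p)).
Proof.
move=> s0 + hL; elim: P => [_|p P ih hP].
  by rewrite big_nil mulr1; apply: csum_ext hL => z; rewrite /sieved.
rewrite big_cons [(1 - _) * _]mulrC mulrA; apply: sieve_step => //.
apply: ih; case: hP => /= /andP[_ uP] hP; split=> // q qP.
by apply: hP; rewrite inE qP orbT.
Qed.

(** A finite set A0 carries the sum up to e / 2, and y is the largest norm in A0; hence any finite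
    set of points of norm above y is disjoint from A0 and adds at most e. *)
Lemma gwt_tail s e : 1 < s -> 0 < e -> exists y : nat,
  abs_bounded (fun z => if (y < gnorm z)%N then gwt s z else 0) e.
Proof.
move=> s1 e0; have [B hB] := gwt_bounded s1.
have [L hL] := has_sum_ex hB.
have e2 : 0 < e / 2 by rewrite divr_gt0.
have [A0 hA0] := hL _ e2.
exists (\max_(z <- A0) gnorm z)%N => A.
set y := (\max_(z <- A0) _)%N.
pose A' := [fset z in A | (y < gnorm z)%N].
have disj : [disjoint A0 & A']%fset.
  apply/fdisjointP => z zA0; rewrite !inE negb_and -leqNgt; apply/orP; right.
  exact: (leq_bigmax_seq z zA0).
have -> : \sum_(z <- A) `|if (y < gnorm z)%N then gwt s z else 0| =
    \sum_(z <- A0 `|` A') gwt s z - \sum_(z <- A0) gwt s z.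
  rewrite (big_fsetID _ (mem A0) (A0 `|` A')) /=.
  have -> : [fset x in A0 `|` A' | x \in A0] = A0.
    by apply/fsetP => z; rewrite !inE; case: (z \in A0); rewrite ?andbF.
  have -> : [fset x in A0 `|` A' | x \notin A0] = A'.
    apply/fsetP => z; rewrite !inE; case: (boolP (z \in A0)) => zA0; rewrite ?andbT ?andbF //.
    by have /fdisjointP/(_ _ zA0)/negbTE := disj; rewrite !inE => ->.
  rewrite addrAC subrr add0r [LHS](big_fsetID _ (fun z => y < gnorm z)%N) /=.
  rewrite [X in _ + X]big_seq [X in _ + X]big1 ?addr0.
    rewrite big_seq [RHS]big_seq; apply: eq_bigr => z; rewrite !inE => /andP[_ ->].
    by rewrite ger0_norm ?gwt_ge0.
  by move=> z; rewrite !inE => /andP[_ /negbTE ->]; rewrite normr0.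
have := hA0 _ (fsubset_refl A0); have := hA0 _ (fsubsetUl A0 A').
rewrite !ler_norml => /andP[a b] /andP[c d]; lra.
Qed.

Lemma unit_sum : exists2 c : R, 1 <= c &
  has_sum (fun z => (gnorm z == 1%N)%:R) c.
Proof.
have [B hB] : exists B, abs_bounded (@gwt R 2) B by apply: gwt_bounded; lra.
have [c hc] : exists c, has_sum (fun z => (gnorm z == 1%N)%:R : R) c.
  apply: (@has_sum_ex _ _ _ B) => A; apply: le_trans (hB A); apply: ler_sum => z _.
  have [z1|_] := eqVneq; last by rewrite normr0 normr_ge0.
  by rewrite gwt_unit.
exists c => //; have := @has_sum_ge _ _ _ c [fset (1 : gauss)] _ hc.
by rewrite big_seq_fset1 gnorm1 eqxx; apply.
Qed.

(** The product is the sum over the z coprime to [P]. The units contribute their number [c], since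
    [chr] is 1 on them; all other z have norm above y and form a tail. The tail bound 1/4 doubles
    because real and imaginary parts are estimated separately. *)
Lemma sieve_estimate : exists2 c : R, 1 <= c & forall k s L, 1 < s ->
  csum (chr k s) L -> exists y, forall P, complete_up_to y P ->
  normc (L * \prod_(p <- P) (1 - chr k s p) - c%:C) <= 1 / 2.
Proof.
have [c c1 hc] := unit_sum; exists c => // k s L s1 hL.
have s0 : 0 < s by apply: lt_trans s1.
have e0 : (0 : R) < 1 / 4 by lra.
have [y hy] := gwt_tail s1 e0; exists y => P hP.
have hcc : csum (fun z => (gnorm z == 1%N)%:R) c%:C.
  split; first by apply: has_sum_ext hc => z; case: (_ == _).
  move=> e e0'; exists fset0 => A _; rewrite big1 ?subr0 ?normr0 ?ltW //.
  by move=> z _; case: (_ == _).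
have := csum_le _ hy (csumB (sieve s0 hP.1 hL) hcc).
rewrite (_ : (1 / 4) *+ 2 = 1 / 2); last by rewrite mulr2n; lra.
apply => z; have [z1|z1] := eqVneq (gnorm z) 1%N.
  rewrite /sieved ifT; last first.
    apply/allP => p pP; apply/asboolPn => /gdvd_norm; rewrite z1 dvdn1 => /eqP p1.
    by have [[]] := hP.1.2 _ pP; rewrite p1.
  by rewrite chr_unit // subrr normc0; case: ifP => // _; rewrite gwt_ge0.
rewrite subr0 /sieved; case: ifP => cz; last first.
  by rewrite normc0; case: ifP => // _; rewrite gwt_ge0.
have [->|z0] := eqVneq z 0.
  by rewrite chr0 // normc0 gwt0 // if_same.
have [/eqP|yz] := coprime_to_small hP z0 cz; first by rewrite (negPf z1).
rewrite yz.
by rewrite normc_chr.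
Qed.

Lemma gwt_prime_le s p : 1 <= s -> gprime p -> gwt s p <= 1 / 2 :> R.
Proof.
move=> s1 pp; apply: (le_trans (gwt_le (gprime_neq0 pp) s1)).
have n0 : (0 : R) < (gnorm p)%:R by rewrite ltr0n (ltn_trans _ pp.1).
rewrite /gwt powR_inv1 ?(ltW n0) // mul1r lef_pV2 ?posrE // ler_nat.
by case: pp.
Qed.

(** Expand |1 - x|^2 = 1 - 2 Re x + |x|^2 and use 1 + t <= exp t. The quadratic term is at most
    [gwt 2 p], whose sum over all p is bounded independently of s. *)
Lemma normc_sub1_le k s p : 1 < s -> p != 0 ->
  normc (1 - chr k s p) ^+ 2 <= expR (- 2 * Re (chr k s p) + gwt (2 : R) p).
Proof.
move=> s1 p0; have s0 : 0 < s by apply: lt_trans s1.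
have h : normc (1 - chr k s p) ^+ 2 = 1 + (- 2 * Re (chr k s p) + gwt s p ^+ 2).
  by rewrite -(normc_chr k p s0) !normc_sqr cReB cImB /=; ring.
rewrite h; apply: (le_trans (expR_ge1Dx _)); rewrite ler_expR lerD2l.
have -> : gwt s p ^+ 2 = gwt (s + s) p.
  by rewrite /gwt opprD powRD ?expr2 //; apply/implyP => _; rewrite pnatr_eq0 gnorm_eq0.
by apply: gwt_le => //; lra.
Qed.

(* Only an upper bound is claimed: a matching lower bound would amount to the
   nonvanishing of the L-series at 1, which is not needed. *)
Lemma prime_sum_bounded k : (0 < k)%N -> exists C : R, forall s, 1 < s -> s <= 2 ->
  exists y, forall P, complete_up_to y P ->
  \sum_(p <- P) Re (chr k s p) <= C.
Proof.
move=> k0; have [C0 hC0] := chr_sum_bounded R k0.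
have [c c1 hc] := sieve_estimate.
have [B hB] : exists B, abs_bounded (@gwt R 2) B by apply: gwt_bounded; lra.
pose C := `|C0| + 1; have C1 : 1 <= C by rewrite /C; have := normr_ge0 C0; lra.
exists (ln (4 * C ^+ 2 * expR B) / 2) => s s1 s2.
have s0 : 0 < s by apply: lt_trans s1.
have [L hL] := csum_chr_ex k s1.
have LC : normc L <= C.
  by apply: (le_trans (hC0 _ _ s1 s2 hL)); rewrite /C; have := ler_norm C0; lra.
have [y hy] := hc _ _ _ s1 hL; exists y => P hP.
have Pn0 p : p \in P -> p != 0 by move=> pP; apply: gprime_neq0; case: (hP.1.2 _ pP).
(* The sieved sum is within 1/2 of c >= 1, so its absolute value is at least 1/2. *)
have h1 : 1 / 2 <= C * \prod_(p <- P) normc (1 - chr k s p).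
  have := hy _ hP; rewrite normcBC => h; have := le_trans (normcB_ge _ _) h.
  rewrite normcR ger0_norm; last by lra.
  rewrite normcM normc_prod => h'.
  have : normc L * \prod_(p <- P) normc (1 - chr k s p) <=
         C * \prod_(p <- P) normc (1 - chr k s p).
    by rewrite ler_wpM2r // prodr_ge0 // => p _; exact: normc_ge0.
  lra.
have h2 : 1 / 4 <= C ^+ 2 * \prod_(p <- P) normc (1 - chr k s p) ^+ 2.
  rewrite prodrXl -exprMn.
  have -> : (1 / 4 : R) = (1 / 2) ^+ 2 by rewrite expr2; lra.
  by rewrite lerXn2r // nnegrE; lra.
have h3 : \prod_(p <- P) normc (1 - chr k s p) ^+ 2 <=
    expR (- 2 * \sum_(p <- P) Re (chr k s p) + B).
  apply: (@le_trans _ _ (expR (\sum_(p <- P) (- 2 * Re (chr k s p) + gwt (2 : R) p)))).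
    rewrite expR_sum big_seq [leRHS]big_seq; apply: ler_prod => p pP.
    by rewrite exprn_ge0 ?normc_ge0 //= normc_sub1_le // Pn0.
  rewrite ler_expR big_split /= -mulr_sumr lerD2l.
  apply: le_trans (hB [fset p in P]).
  rewrite [leRHS](perm_big P) /=; last first.
    apply: uniq_perm; [exact: fset_uniq|by case: hP => [[]]|by move=> p; rewrite !inE].
  by apply: ler_sum => p _; exact: ler_norm.
move: h3; set S := \sum_(p <- P) _ => h3.
have h4 : 1 / 4 <= C ^+ 2 * expR (- 2 * S + B).
  by apply: (le_trans h2); rewrite ler_pM2l // exprn_gt0 // (lt_le_trans _ C1).
rewrite ler_pdivlMr // -ler_expR lnK; last first.
  rewrite posrE; apply: mulr_gt0; last exact: expR_gt0.
  by apply: mulr_gt0 => //; rewrite exprn_gt0 // (lt_le_trans _ C1).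
have h5 : expR (2 * S) * expR (- 2 * S) = 1 by rewrite -expRD mulNr subrr expR0.
have e0 := expR_gt0 (2 * S).
have : expR (2 * S) * (1 / 4) <= expR (2 * S) * (C ^+ 2 * expR (- 2 * S + B)).
  by rewrite ler_pM2l.
rewrite expRD [leRHS]mulrCA [expR (2 * S) * (_ * expR B)]mulrA h5 mul1r => h6.
rewrite [S * 2]mulrC; lra.
Qed.

(** At frequency 0 the full sum L exceeds (c + 1/2) exp (2 K) for a suitable s, while the sieved sum
    is at most c + 1/2; so the Euler product is at most exp (- 2 K). Each factor satisfies 1 - x >=
    exp (- 2 x), as 0 <= x <= 1/2. *)
Lemma prime_sum_unbounded (K : R) : exists s, [/\ 1 < s, s <= 2 &
  exists y, forall P, complete_up_to y P -> K <= \sum_(p <- P) gwt s p].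
Proof.
have [c c1 hc] := sieve_estimate.
have c0 : 0 < c + 1 / 2 by lra.
have [s [s1 s2 [A hA]]] := gwt_unbounded ((c + 1 / 2) * expR (2 * K)).
have s0 : 0 < s by apply: lt_trans s1.
exists s; split=> //.
have [L hL] := csum_chr_ex 0 s1.
have hL1 : (c + 1 / 2) * expR (2 * K) <= normc L.
  apply: (le_trans hA); apply: le_trans (le_trans (ler_norm _) (normc_Re _)).
  apply: has_sum_ge => [z|]; first exact: gwt_ge0.
  by apply: has_sum_ext hL.1 => z; rewrite /chr muln0 expr0 mul1r.
have [y hy] := hc _ _ _ s1 hL; exists y => P hP.
have h1 : normc L * \prod_(p <- P) normc (1 - chr 0 s p) <= c + 1 / 2.
  rewrite -normc_prod -normcM.
  have := le_trans (normcB_ge _ _) (hy _ hP).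
  rewrite normcR ger0_norm; lra.
have h2 : expR (- (2 * \sum_(p <- P) gwt s p)) <= \prod_(p <- P) normc (1 - chr 0 s p).
  rewrite mulr_sumr -sumrN expR_sum big_seq [leRHS]big_seq; apply: ler_prod => p pP.
  rewrite expR_ge0 andTb; have [pp _] := hP.1.2 _ pP.
  have hp := gwt_prime_le (ltW s1) pp; have hp0 := gwt_ge0 s p.
  rewrite /chr muln0 expr0 mul1r -(rmorphB (real_complex R) 1) normcR ger0_norm; last by lra.
  move: (gwt s p) hp hp0 => x hp hp0; rewrite expRN.
  have h := expR_ge1Dx (2 * x).
  rewrite -[leLHS]mul1r ler_pdivrMr ?expR_gt0 //.
  apply: (@le_trans _ _ ((1 - x) * (1 + 2 * x))); first by nra.
  by rewrite ler_wpM2l //; lra.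
move: h2; set S := \sum_(p <- P) _ => h2.
have h3 : (c + 1 / 2) * expR (2 * K) * expR (- (2 * S)) <= c + 1 / 2.
  apply: le_trans h1; apply: ler_pM => //; rewrite ?expR_ge0 // mulr_ge0 ?expR_ge0 //; lra.
move: h3; rewrite -mulrA -expRD -[leRHS]mulr1 ler_pM2l // expR_le1; lra.
Qed.

End Sieve.

(** * Gaussian primes of small angle *)

Lemma central_bin_ge M : (0 < M)%N -> (4 ^ M <= 2 * M * 'C(2 * M, M))%N.
Proof.
case: M => // M _; elim: M => [//|M ih].
set n := M.+1 in ih *; rewrite expnS.
have h1 := mul_bin_diag (2 * n).+2 n.
have h2 := mul_bin_diag (2 * n).+1 n.
have h3 : 'C((2 * n).+1, n) = 'C((2 * n).+1, n.+1).
  by rewrite -bin_sub; [congr 'C(_, _); lia|lia].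
rewrite /= in h1 h2; rewrite (_ : (2 * n.+1 = (2 * n).+2)%N); last by lia.
by move: ih h1 h2 h3; move: 'C(_, _) 'C(_, _) 'C(_, _) 'C(_, _) => a b c d; nia.
Qed.

Lemma mul4_le_exp k : (4 * k.+1 <= 4 ^ k.+1)%N.
Proof.
elim: k => [|k ih]; first exact: leqnn.
by rewrite expnS; move: (4 ^ k.+1)%N ih => x ih; lia.
Qed.

(** It rests on j (n + 2 - j) 'C(n + 2, j) = (n + 2) (n + 1) 'C(n, j - 1). With n + 2 = 2 M one has
    (j - M)^2 = M^2 - j (2 M - j), so this evaluates the weighted part of the sum in [wb_sum]. *)
Lemma sum_bin_weight (F : comNzRingType) (u : F) (n : nat) :
  \sum_(j < n.+3) (j%:R * (n.+2%:R - j%:R)) * ('C(n.+2, j)%:R * u ^+ j) =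
  (n.+2 * n.+1)%:R * (u * (1 + u) ^+ n).
Proof.
rewrite big_ord_recl /= !mul0r add0r big_ord_recr /= /bump /= add1n.
rewrite subrr mulr0 mul0r addr0 exprDn mulr_sumr mulr_sumr.
apply: eq_bigr => j _; rewrite /bump /= add1n expr1n mul1r.
have jn : (j <= n)%N by rewrite -ltnS ltn_ord.
have e : (j.+1 * (n.+2 - j.+1) * 'C(n.+2, j.+1) = n.+2 * n.+1 * 'C(n, j))%N.
  rewrite mulnAC -(mul_bin_diag n.+2 j) /= -mulnA -[RHS]mulnA; congr (_ * _)%N.
  by rewrite mulnC subSS -mul_bin_down.
rewrite -natrB; last by lia.
by rewrite [LHS]mulrA -!natrM e natrM -[u ^+ j *+ _]mulr_natr exprS; ring.
Qed.

Lemma bernoulli (R : realType) (h : R) n : 0 <= h -> 1 + n%:R * h <= (1 + h) ^+ n.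
Proof.
move=> h0; elim: n => [|n ih]; first by rewrite mul0r addr0.
rewrite exprS -natr1; have := ler_wpM2l (addr_ge0 ler01 h0) ih.
by have := ler0n R n; nra.
Qed.

Lemma geometric_beats_cube (R : realType) (rho : R) : 0 < rho -> rho < 1 ->
  exists M : nat, (2 <= M)%N /\ 4 * M%:R ^+ 3 * rho ^+ M.-1 <= 1.
Proof.
move=> r0 r1; pose h := rho^-1 - 1.
have h0 : 0 < h by rewrite subr_gt0 invf_gt1.
have e : rho = (1 + h)^-1 by rewrite /h addrC subrK invrK.
(* Take M = 4 j + 1 <= 5 j. Bernoulli gives rho^j j h <= 1, whose fourth power contains rho^(M - 1),
   and 4 (5 j)^3 = 500 j^3 <= (j h)^4 as soon as j h^4 >= 500. *)
clearbody h.
have [j hj] : exists j : nat, 500 / h ^+ 4 <= j%:R.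
  exists (Num.bound (500 / h ^+ 4)); apply/ltW/archi_boundP.
  by rewrite divr_ge0 ?ler0n ?exprn_ge0 ?(ltW h0).
have j1 : (0 < j)%N.
  by rewrite -(ltr0n R); apply: lt_le_trans hj; rewrite divr_gt0 ?ltr0n ?exprn_gt0.
exists (4 * j).+1; split; first by lia.
have jR : (1 : R) <= j%:R by rewrite ler1n.
have rj : rho ^+ j * (j%:R * h) <= 1.
  have h1 : 0 < 1 + h by rewrite addr_gt0.
  rewrite e exprVn ler_pdivrMl ?exprn_gt0 // mulr1.
  by have := bernoulli j (ltW h0); lra.
have a0 : 0 <= rho ^+ j * (j%:R * h) by rewrite !mulr_ge0 ?exprn_ge0 ?(ltW r0) ?(ltW h0).
have rj4 : (rho ^+ j * (j%:R * h)) ^+ 4 <= 1 by rewrite exprn_ile1.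
apply: le_trans rj4; rewrite /= !exprMn -exprM mulnC mulrC ler_pM2l ?exprn_gt0 //.
have h4 : 500 <= j%:R * h ^+ 4 by move: hj; rewrite ler_pdivrMr ?exprn_gt0.
apply: (@le_trans _ _ (4 * (5 * j%:R) ^+ 3)).
  rewrite ler_pM2l ?ltr0n // lerXn2r ?nnegrE ?mulr_ge0 ?ler0n // -natrM ler_nat; lia.
have -> : 4 * (5 * j%:R) ^+ 3 = j%:R ^+ 3 * 500 :> R by ring.
have -> : j%:R ^+ 4 * h ^+ 4 = j%:R ^+ 3 * (j%:R * h ^+ 4) by ring.
by rewrite ler_pM2l // exprn_gt0 // ltr0n.
Qed.

Section Certificate.
Variable R : realType.

(* Up to the factor [(j - M)^2 - 1], the Fourier coefficients of
   [(2 + 2 cos t)^M], indexed by the frequency [j - M].  The factor subtracts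
   the function from minus its second derivative; both are tiny away from
   [t = 0], so that dropping the negative mean [- 'C(2 * M, M)] leaves a cosine
   polynomial with nonnegative coefficients that is positive there. *)
Definition wb (M j : nat) : R := ((j%:R - M%:R) ^+ 2 - 1) * 'C(2 * M, j)%:R.

Lemma wb_ge0 M j : j != M -> 0 <= wb M j.
Proof.
move=> jM; rewrite mulr_ge0 // subr_ge0.
have [h|h] := leqP j M.
  rewrite -sqrrN opprB -natrB // -natrX ler1n expn_gt0 subn_gt0 ltn_neqAle jM h //.
by rewrite -natrB 1?ltnW // -natrX ler1n expn_gt0 subn_gt0 h.
Qed.

Lemma Re_expV (u : R[i]) n : normc u = 1 -> Re (u^-1 ^+ n) = Re (u ^+ n).
Proof.
move=> u1; have un : normc (u ^+ n) = 1 by rewrite normcX u1 expr1n.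
rewrite exprVn; move: (u ^+ n) un => [a b] /(congr1 (fun x => x ^+ 2)).
by rewrite normc_sqr /= expr1n => ->; rewrite divr1.
Qed.

Lemma Re_dist (u : R[i]) M j : normc u = 1 ->
  Re (u ^+ j * u^-1 ^+ M) = Re (u ^+ (maxn j M - minn j M)).
Proof.
move=> u1; have u0 : u != 0.
  by apply/eqP => h; move: u1; rewrite h normc0 => /eqP; rewrite eq_sym oner_eq0.
have [h|h] := leqP M j.
  by rewrite -[in LHS](subnK h) exprD -mulrA -exprMn divff // expr1n mulr1.
rewrite -[X in _^-1 ^+ X](subnKC (ltnW h)) exprD mulrA -exprMn divff // expr1n mul1r.
by rewrite Re_expV.
Qed.

(** On the unit circle (1 + u)^2 / u = 2 + 2 Re u, so the binomial sums divided by u^M become powers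
    of this real number. The last term is the omitted index j = M, where [wb M M] is minus the
    central binomial coefficient. *)
Lemma wb_sum m (M := m.+1) (u : R[i]) : normc u = 1 ->
  \sum_(j < (2 * M).+1 | j != M :> nat) wb M j * Re (u ^+ (maxn j M - minn j M)) =
  (M%:R ^+ 2 - 1) * (2 + 2 * Re u) ^+ M -
  (2 * M * (2 * m).+1)%:R * (2 + 2 * Re u) ^+ m + 'C(2 * M, M)%:R.
Proof.
move=> u1.
have u0 : u != 0.
  by apply/eqP => h; move: u1; rewrite h normc0 => /eqP; rewrite eq_sym oner_eq0.
set q := 2 + 2 * Re u.
have qE : (1 + u) ^+ 2 * u^-1 = q%:C.
  have -> : (1 + u) ^+ 2 * u^-1 = 2 + (u + u^-1) by field.
  have uV : Re u^-1 = Re u by have := Re_expV 1 u1; rewrite !expr1.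
  have : Im u^-1 = - Im u.
    move: (u1) => /(congr1 (fun x => x ^+ 2)); rewrite normc_sqr expr1n.
    by case: (u) => a b /= ->; rewrite divr1.
  rewrite /q; move: uV; case: (u) (u^-1) => a b [c d] /= -> ->; apply/eqP.
  by rewrite eq_complex /=; apply/andP; split; apply/eqP; ring.
have M2 : (2 * M = (2 * m).+2)%N by rewrite /M; lia.
have tot : \sum_(j < (2 * M).+1) ((wb M j)%:C * (u ^+ j * u^-1 ^+ M)) =
   ((M%:R ^+ 2 - 1) * q ^+ M - (2 * M * (2 * m).+1)%:R * q ^+ m)%:C.
  have -> : \sum_(j < (2 * M).+1) ((wb M j)%:C * (u ^+ j * u^-1 ^+ M)) =
    ((M%:R ^+ 2 - 1) * (\sum_(j < (2 * M).+1) 'C(2 * M, j)%:R * u ^+ j)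
    - \sum_(j < (2 * M).+1) (j%:R * ((2 * M)%:R - j%:R)) * ('C(2 * M, j)%:R * u ^+ j))
     * u^-1 ^+ M.
    rewrite mulr_sumr -sumrB mulr_suml; apply: eq_bigr => j _.
    by rewrite /wb rmorphM rmorphB rmorphXn rmorphB /= !rmorph_nat rmorph1 natrM; ring.
  have -> : \sum_(j < (2 * M).+1) 'C(2 * M, j)%:R * u ^+ j = (1 + u) ^+ (2 * M).
    by rewrite exprDn; apply: eq_bigr => j _; rewrite expr1n mul1r mulr_natl.
  rewrite M2 sum_bin_weight -M2.
  rewrite rmorphB !rmorphM rmorphB !rmorphXn /= -qE !rmorph_nat rmorph1.
  rewrite mulrBl; congr (_ - _).
    by rewrite -mulrA; congr (_ * _); rewrite exprMn -exprM.
  rewrite -mulrA; congr (_ * _); rewrite exprMn -exprM /M /= exprS.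
  by rewrite -!mulrA [u^-1 * _]mulrC [_ ^+ m * _]mulrC; field.
have tot2 : \sum_(j < (2 * M).+1) wb M j * Re (u ^+ (maxn j M - minn j M)) =
   (M%:R ^+ 2 - 1) * q ^+ M - (2 * M * (2 * m).+1)%:R * q ^+ m.
  have := congr1 (fun x => Re x) tot; rewrite /= => <-.
  rewrite (big_morph _ (@cReD R) (erefl : Re 0 = 0 :> R)).
  by apply: eq_bigr => j _; rewrite cReM /= mul0r subr0 Re_dist.
have jM : (M < (2 * M).+1)%N by lia.
rewrite -tot2 [X in _ = X + _](bigD1 (Ordinal jM)) //=.
rewrite maxnn minnn subnn expr0 mulr1 /wb subrr expr0n sub0r mulN1r addrAC addNr add0r.
by apply: eq_bigl => j; rewrite -(inj_eq val_inj).
Qed.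

(** At u = 1 the closed form of [wb_sum] is 4^m (2 M - 4) + 'C(2 M, M), with M >= 2. Away from 1, q
    <= 4 (1 - eta / 2), and the choice of M makes the only negative term at most 4^m / M, whereas
    the central coefficient is at least 2 * 4^m / M; the difference 4^m / M is at least 1. *)
Lemma certificate (eta : R) : 0 < eta -> eta < 1 -> exists M : nat,
  forall u : R[i], normc u = 1 -> u = 1 \/ Re u <= 1 - eta ->
  1 <= \sum_(j < (2 * M).+1 | j != M :> nat) wb M j * Re (u ^+ (maxn j M - minn j M)).
Proof.
move=> e0 e1.
have rho0 : 0 < 1 - eta / 2 by lra.
have rho1 : 1 - eta / 2 < 1 by lra.
have [M0 [M2 hM]] := geometric_beats_cube rho0 rho1.
have [m mE] : exists m, M0 = m.+1 by exists M0.-1; lia.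
rewrite {}mE /= in M2 hM; set M := m.+1 in M2 hM *; exists M => u u1 hu.
have m1 : (1 : R) <= m%:R by rewrite ler1n; lia.
have ME : M%:R = m%:R + 1 :> R by rewrite natr1.
rewrite wb_sum // -/M natrM natrM -[(2 * m).+1%:R]natr1 natrM ME.
have c1 : (1 : R) <= 'C(2 * M, M)%:R by rewrite ler1n bin_gt0; lia.
have c2 : (4 : R) ^+ M <= 2 * (m%:R + 1) * 'C(2 * M, M)%:R.
  by rewrite -ME -natrM -natrM -natrX ler_nat; apply: central_bin_ge.
case: hu => [->|hu].
  rewrite /= mulr1 (_ : (2 + 2 : R) = 4); last by lra.
  have := exprn_ge0 m (ler0n R 4); rewrite [4 ^+ M]exprS; move: (4 ^+ m) => x x0.
  move: m1 c1; move: (m%:R) ('C(_, _)%:R) => y c y1 cc.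
  have : 0 <= x * (y - 1) by rewrite mulr_ge0 // subr_ge0.
  by rewrite expr2; lra.
set q := 2 + 2 * Re u.
have q0 : 0 <= q by have := normc_Re u; rewrite u1 /q ler_norml => /andP[+ _]; lra.
have hq : q ^+ m <= 4 ^+ m * (1 - eta / 2) ^+ m.
  rewrite -exprMn; apply: lerXn2r; rewrite ?nnegrE //; rewrite /q in q0 *; lra.
have qM : 0 <= ((m%:R + 1) ^+ 2 - 1) * q ^+ M.
  by rewrite mulr_ge0 ?exprn_ge0 // subr_ge0 expr2; nra.
have X1 : 4 * (m%:R + 1) <= (4 : R) ^+ M.
  rewrite -ME -natrM -natrX ler_nat /M.
  exact: mul4_le_exp.
rewrite ME in hM.
move: hM hq c2 X1 qM; rewrite [4 ^+ M]exprS.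
have := exprn_ge0 m q0.
have : 0 <= (1 - eta / 2) ^+ m by rewrite exprn_ge0 //; lra.
have : (0 : R) < 4 ^+ m by rewrite exprn_gt0.
move: (4 ^+ m) ((1 - eta / 2) ^+ m) (q ^+ m) (((m%:R + 1) ^+ 2 - 1) * q ^+ M) (m%:R : R) m1 ('C(2 * M, M)%:R : R) c1.
move=> X r Q W x x1 c c1 X0 r0 Q0 hM hq c2 X1 qM.
have h1 : 2 * (x + 1) * (2 * x + 1) * Q <= 4 * (x + 1) ^+ 2 * (X * r).
  apply: ler_pM => //; rewrite ?expr2; nra.
have h2 : X * (4 * (x + 1) ^+ 3 * r) <= X by rewrite -[leRHS]mulr1 ler_pM2l.
have h3 : (x + 1) * (4 * (x + 1) ^+ 2 * (X * r)) <= X.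
  by apply: le_trans h2; rewrite le_eqVlt; apply/orP; left; apply/eqP; ring.
have x2 : 0 < x + 1 by lra.
have h4 : (x + 1) * (2 * (x + 1) * (2 * x + 1) * Q) <= X.
  by apply: le_trans h3; rewrite ler_pM2l.
have h5 : (x + 1) * 1 <= (x + 1) * (c - 2 * (x + 1) * (2 * x + 1) * Q).
  rewrite mulrBr; lra.
by rewrite ler_pM2l // in h5; lra.
Qed.

Lemma small_angle_prime (eta : R) : 0 < eta -> eta < 1 ->
  exists p, [/\ gprime p, dir R p ^+ 4 != 1 & 1 - eta < Re (dir R p ^+ 4)].
Proof.
move=> e0 e1; apply: contrapT => hn.
have hp p : gprime p -> dir R p ^+ 4 = 1 \/ Re (dir R p ^+ 4) <= 1 - eta.
  move=> pp; have [->|u1] := eqVneq (dir R p ^+ 4) 1; first by left.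
  right; rewrite leNgt; apply/negP => h; apply: hn; by exists p.
have [M hM] := certificate e0 e1.
pose e (j : 'I_(2 * M).+1) := (maxn j M - minn j M)%N.
have hC (j : 'I_(2 * M).+1) : exists C : R, (j != M :> nat) -> forall s, 1 < s -> s <= 2 ->
    exists y, forall P, complete_up_to y P -> \sum_(p <- P) Re (chr (e j) s p) <= C.
  have [jM|jM] := boolP (j != M :> nat); last by exists 0.
  have [|C hC] := @prime_sum_bounded R (e j); first by rewrite /e; lia.
  by exists C.
have [C {}hC] := choice hC.
(* The bounds [C j] are uniform in s, so s can be chosen after them. The cutoffs y depend on s and
   on the frequency; one list [P] complete up to their maximum serves all. *)
have [s [s1 s2 [y0 hy0]]] := prime_sum_unbounded
  (\sum_(j < (2 * M).+1 | j != M :> nat) wb M j * C j + 1).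
have hy (j : 'I_(2 * M).+1) : exists y, (j != M :> nat) -> forall P, complete_up_to y P ->
    \sum_(p <- P) Re (chr (e j) s p) <= C j.
  have [jM|jM] := boolP (j != M :> nat); last by exists 0%N.
  by have [y hy] := hC j jM s s1 s2; exists y.
have [y {}hy] := choice hy.
have [P hP] := complete_up_to_ex (maxn y0 (\max_j y j)).
have := hy0 P (complete_up_to_le (leq_maxl _ _) hP).
suff : \sum_(p <- P) gwt s p <= \sum_(j < (2 * M).+1 | j != M :> nat) wb M j * C j by lra.
apply: (@le_trans _ _ (\sum_(p <- P) \sum_(j < (2 * M).+1 | j != M :> nat)
    wb M j * Re (chr (e j) s p))).
  rewrite big_seq [leRHS]big_seq; apply: ler_sum => p pP.
  have [pp _] := hP.1.2 _ pP; have p0 := gprime_neq0 pp.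
  have := hM (dir R p ^+ 4); rewrite normcX normc_dir // expr1n => /(_ erefl (hp _ pp)).
  move=> /(ler_wpM2r (gwt_ge0 s p)); rewrite mul1r => /le_trans; apply.
  rewrite mulr_suml; apply: ler_sum => j _.
  by rewrite /chr cReM /= mulr0 subr0 -exprM mulrA.
rewrite exchange_big /=; apply: ler_sum => j jM.
rewrite -mulr_sumr ler_wpM2l ?wb_ge0 // hy //.
apply: complete_up_to_le hP; apply: leq_trans (leq_maxr _ _).
exact: leq_bigmax.
Qed.

End Certificate.

(** * Lattice points on circles *)

Lemma lattice_pointsE n z : lattice_points n z <-> gnorm z = n.
Proof.
rewrite /lattice_points /= -gnormE; split; last by move=> ->.
by case.
Qed.

Lemma mem_lattice n z : (z \in lattice_seq n) = (gnorm z == n).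
Proof. by apply/idP/eqP => [/mem_lattice_seq/lattice_pointsE|/lattice_pointsE/mem_lattice_seq]. Qed.

Section Fourier.
Variable R : realType.
Implicit Types (z p : gauss).

Local Notation u := (fun z => dir R z ^+ 4).

Lemma cos4_dir n z : (0 < n)%N -> gnorm z = n ->
  cos (4 * angle (project R n z)) = Re (u z).
Proof.
move=> n0 zn; have hz : lattice_points n z by apply/lattice_pointsE.
have hu := project_unit_circle R n0 hz; rewrite cos4_angle //.
have -> : dir R z = (project R n z).1 +i* (project R n z).2.
  by rewrite /dir zn /emb -fmorphV; simpc.
move: hu; rewrite /unit_circle /=; move: (z.1%:~R / _) (z.2%:~R / _) => x y h.
have -> : x ^+ 4 = (x ^+ 2) ^+ 2 by rewrite -exprM.
have -> : x * (x * (x * x - y * y) - y * (x * y + y * x)) -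
  y * (x * (x * y + y * x) + y * (x * x - y * y)) =
  (x ^+ 2) ^+ 2 - 6 * x ^+ 2 * y ^+ 2 + (y ^+ 2) ^+ 2 by ring.
have -> : y ^+ 2 = 1 - x ^+ 2 by rewrite -h addrAC subrr add0r.
by ring.
Qed.

Lemma nu_hat4_dir n : (0 < n)%N ->
  nu_hat4 R n = (N n)%:R^-1 * \sum_(z <- lattice_seq n) Re (u z).
Proof.
move=> n0; rewrite nu_hat4E //; congr (_ * _).
rewrite big_seq [RHS]big_seq; apply: eq_bigr => z.
by rewrite mem_lattice => /eqP; exact: cos4_dir.
Qed.

(** Used for the inert prime 3 and the ramified prime 1 + i: each divides every point of the scaled
    norm, so multiplication by it is a bijection between the two circles. *)
Lemma lattice_seq_scale c n : c != 0 ->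
  (forall z, gnorm z = (gnorm c * n)%N -> gdvd c z) ->
  perm_eq (lattice_seq (gnorm c * n)) [seq c * z | z <- lattice_seq n].
Proof.
move=> c0 hc; apply: uniq_perm; first exact: lattice_seq_uniq.
  by rewrite map_inj_uniq; [exact: lattice_seq_uniq|exact: gmulI].
move=> z; rewrite mem_lattice; apply/eqP/mapP => [zc|[w + ->]]; last first.
  by rewrite mem_lattice gnormM => /eqP ->.
have [w zw] := hc z zc; exists w => //; rewrite mem_lattice.
move: zc; rewrite zw gnormM => /eqP; rewrite eqn_pmul2l //.
by rewrite gnorm_gt0.
Qed.

Lemma N_scale c n : c != 0 ->
  (forall z, gnorm z = (gnorm c * n)%N -> gdvd c z) ->
  N (gnorm c * n) = N n.
Proof.
move=> c0 hc; rewrite /N (perm_size (lattice_seq_scale c0 hc)).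
by rewrite size_map.
Qed.

Lemma Re_realM (b : R) (x : R[i]) : Re (b%:C * x) = b * Re x.
Proof. by case: x => c d /=; rewrite mul0r subr0. Qed.

Lemma nu_hat4_scale c n (b : R) : c != 0 -> (0 < n)%N -> u c = b%:C ->
  (forall z, gnorm z = (gnorm c * n)%N -> gdvd c z) ->
  nu_hat4 R (gnorm c * n) = b * nu_hat4 R n.
Proof.
move=> c0 n0 ucb hc; rewrite !nu_hat4_dir ?muln_gt0 ?gnorm_gt0 ?c0 //.
rewrite N_scale // (perm_big _ (lattice_seq_scale c0 hc)) big_map.
rewrite [RHS]mulrCA [b * _]mulr_sumr; congr (_ * _); apply: eq_bigr => z _.
by rewrite dirM exprMn ucb Re_realM.
Qed.

Lemma gdvd3 n z : gnorm z = (gnorm (3, 0)%R * n)%N -> gdvd (3, 0) z.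
Proof.
move=> /(congr1 Posz); rewrite PoszM !gnormE /=; case: z => x y /= h.
exists ((x %/ 3)%Z, (y %/ 3)%Z); rewrite gmulE /=.
have hx := divz_eq x 3; have hy := divz_eq y 3.
have rx0 : 0 <= (x %% 3)%Z by apply: modz_ge0.
have ry0 : 0 <= (y %% 3)%Z by apply: modz_ge0.
have rx3 : (x %% 3)%Z < 3 by apply: ltz_pmod.
have ry3 : (y %% 3)%Z < 3 by apply: ltz_pmod.
move: (x %/ 3)%Z (x %% 3)%Z (y %/ 3)%Z (y %% 3)%Z hx hy rx0 rx3 ry0 ry3 => q r q' r' hx hy rx0 rx3 ry0 ry3.
have e : r ^+ 2 + r' ^+ 2 = 3 * (3 * Posz n - (3 * q ^+ 2 + 2 * q * r + 3 * q' ^+ 2 + 2 * q' * r')).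
  move: h; rewrite hx hy expr0n addr0 => h.
  have : (q * 3 + r) ^+ 2 + (q' * 3 + r') ^+ 2 = r ^+ 2 + r' ^+ 2 + 3 * (3 * q ^+ 2 + 2 * q * r + 3 * q' ^+ 2 + 2 * q' * r') by ring.
  by rewrite h; lia.
have [r00 r'00] : r = 0 /\ r' = 0.
  move: (3 * _ - _) e => w e.
  have hr : r = 0 \/ r = 1 \/ r = 2 by lia.
  have hr' : r' = 0 \/ r' = 1 \/ r' = 2 by lia.
  by case: hr => [hr|[hr|hr]]; case: hr' => [hr'|[hr'|hr']]; split=> //;
    move: e; rewrite hr hr' ?expr0n ?expr1n /=; lia.
by rewrite hx hy r00 r'00; congr pair; ring.
Qed.

Lemma gdvd11 n z : gnorm z = (gnorm (1, 1)%R * n)%N -> gdvd (1, 1) z.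
Proof.
move=> /(congr1 Posz); rewrite PoszM !gnormE /=; case: z => x y /= h.
exists (((x + y) %/ 2)%Z, ((y - x) %/ 2)%Z); rewrite gmulE /=.
have h1 := divz_eq (x + y) 2; have h2 := divz_eq (y - x) 2.
have r1 : ((x + y) %% 2)%Z = 0.
  have hs : (x + y) * (x + y) = 2 * (Posz n + x * y) by move: h; rewrite !expr1n; lia.
  have := modz_ge0 (x + y) (isT : 2 != 0 :> int); have := ltz_pmod (x + y) (isT : 0 < 2 :> int).
  move: ((x + y) %/ 2)%Z ((x + y) %% 2)%Z h1 => q r h1 a b.
  have [//|r1] : r = 0 \/ r = 1 by lia.
  move: hs; rewrite {}h1 {}r1.
  have -> : (q * 2 + 1) * (q * 2 + 1) = 2 * (2 * q ^+ 2 + 2 * q) + 1 by ring.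
  by lia.
have r2 : ((y - x) %% 2)%Z = 0.
  by rewrite (_ : y - x = (- x) * 2 + (x + y)) ?modzMDl //; ring.
rewrite r1 r2 in h1 h2; congr pair; lia.
Qed.

Lemma u_real x : x != 0 -> u ((x, 0) : gauss) = 1.
Proof.
move=> x0; rewrite /dir /emb /gnorm /= expr0n addr0.
have -> : (absz (x ^+ 2))%:R = (x%:~R) ^+ 2 :> R.
  by rewrite -rmorphXn /= -[in RHS](gez0_abs (sqr_ge0 x)).
rewrite sqrtr_sqr complexr0 -fmorphV -rmorphM -rmorphXn /= expr_div_n.
have -> : `|x%:~R| ^+ 4 = x%:~R ^+ 4 :> R.
  by rewrite -[4%N]/(2 * 2)%N !exprM real_normK // num_real.
by rewrite divff // expf_neq0 // intr_eq0.
Qed.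

Lemma u_imag x : x != 0 -> u ((0, x) : gauss) = 1.
Proof.
move=> x0; have -> : ((0, x) : gauss) = ((0, 1) : gauss) * ((x, 0) : gauss).
  by rewrite gmulE /=; congr pair; ring.
by rewrite dirM exprMn u_real // mulr1 dir_unit.
Qed.

Lemma u3 : u (3, 0) = (1 : R)%:C.
Proof. exact: u_real. Qed.

Lemma u11 : u (1, 1) = (-1 : R)%:C.
Proof.
rewrite /dir expr_div_n -!rmorphXn /=.
have -> : Num.sqrt (gnorm (1, 1))%:R ^+ 4 = 4 :> R.
  by rewrite -[4%N]/(2 * 2)%N exprM sqr_sqrtr // -natrX.
have -> : emb R (1, 1) ^+ 4 = (- 4 : R)%:C.
  rewrite /emb /= !exprS expr0 mulr1; simpc.
  by apply/eqP; rewrite eq_complex /=; apply/andP; split; apply/eqP; ring.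
by rewrite -fmorphV -rmorphM /= mulNr divff.
Qed.

End Fourier.

(** * Points whose norm is a power of the norm of a Gaussian prime *)

Section PrimePower.
Variable R : realType.
Implicit Types (z p v : gauss).

Local Notation u := (fun z => dir R z ^+ 4).

Lemma u_neq0 z : z != 0 -> u z != 0.
Proof.
move=> z0; rewrite expf_neq0 //; apply/eqP => h; have := normc_dir R z0.
by rewrite h normc0 => /eqP; rewrite eq_sym oner_eq0.
Qed.

Lemma dir_conj z : z != 0 -> dir R (gconj z) = (dir R z)^-1.
Proof.
move=> z0; have d0 : dir R z != 0 by have := u_neq0 z0; rewrite expf_eq0.
apply: (mulfI d0); rewrite -dirM gmul_conj divff //.
have nn : gnorm ((gnorm z)%:Z, 0) = (gnorm z ^ 2)%N.
  by apply/eqP; rewrite -eqz_nat gnormE expr0n addr0 -mulnn PoszM.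
have n0 : (gnorm z)%:R != 0 :> R by rewrite pnatr_eq0 gnorm_eq0.
rewrite /dir nn natrX sqrtr_sqr ger0_norm // /emb /= complexr0 divff //.
by rewrite fmorph_eq0.
Qed.

Lemma emb_inj : injective (emb R).
Proof. by case=> a b [c d] [/intr_inj -> /intr_inj ->]. Qed.

Lemma embX z n : emb R (z ^+ n) = emb R z ^+ n.
Proof. by elim: n => [|n ih]; rewrite ?expr0 // !exprS embM ih. Qed.

(** If u p is a root of unity, some power of p equals the same power of its conjugate, so p divides
    its conjugate and is associated to it. Then u p equals u (gconj p) = (u p)^-1, that is, its
    square is 1. *)
Lemma not_root_of_unity p d : gprime p -> u p ^+ 2 != 1 -> (0 < d)%N -> u p ^+ d != 1.
Proof.
move=> pp u2 d0; have p0 := gprime_neq0 pp; apply: contra u2 => /eqP ud.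
have dd : dir R p ^+ (2 * d) = dir R (gconj p) ^+ (2 * d).
  have d1 : dir R p ^+ (2 * d) != 0.
    by rewrite expf_neq0 //; have := u_neq0 p0; rewrite expf_eq0.
  rewrite dir_conj // exprVn; apply: (mulIf d1); rewrite mulVf // -exprD.
  by rewrite -ud -exprM; congr (_ ^+ _); lia.
have pe : p ^+ (2 * d) = gconj p ^+ (2 * d).
  apply: emb_inj; rewrite !embX; move: dd; rewrite /dir gnorm_conj !expr_div_n.
  by apply: mulIf; rewrite invr_neq0 // expf_neq0 // fmorph_eq0 gt_eqF // sqrt_gnorm_gt0.
have pd : gdvd p (gconj p ^+ (2 * d)).
  rewrite -pe; have -> : (2 * d = (2 * d).-1.+1)%N by lia.
  by rewrite exprS; apply: gdvd_mulr; exact: gdvdxx.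
have [v pv] := gprime_dvdX pp pd.
have v1 : gnorm v = 1%N.
  have := gnorm_conj p; rewrite pv gnormM => /eqP.
  by rewrite -[X in _ == X]muln1 eqn_pmul2l ?gnorm_gt0 // => /eqP.
have : u (gconj p) = u p by rewrite /= pv dirM exprMn (dir_unit R v1) mulr1.
rewrite /= dir_conj // exprVn => h.
by rewrite expr2 -{1}h mulVf // u_neq0.
Qed.

Definition gunits : seq gauss := [:: (1, 0); (-1, 0); (0, 1); (0, -1)].

Lemma mem_gunits v : (v \in gunits) = (gnorm v == 1%N).
Proof.
apply/idP/eqP => [|/gunitP[] ->] //.
by rewrite !inE => /or4P[] /eqP ->.
Qed.

(** The prime p divides z * gconj z, hence z or gconj z; this splits off a factor p or gconj p from
    z, and induction applies to the quotient. *)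
Lemma lattice_primepow p k z : gprime p -> gnorm z = (gnorm p ^ k)%N ->
  exists v j, [/\ gnorm v = 1%N, (j <= k)%N & z = v * (p ^+ j * gconj p ^+ (k - j))].
Proof.
move=> pp; have p0 := gprime_neq0 pp; elim: k z => [|k ih] z zk.
  by exists z, 0%N; rewrite subnn !expr0 !mulr1.
have nzw w : gnorm (p * w) = (gnorm p ^ k.+1)%N -> gnorm w = (gnorm p ^ k)%N.
  by rewrite gnormM expnS => /eqP; rewrite eqn_pmul2l ?gnorm_gt0 // => /eqP.
have pzz : gdvd p (z * gconj z).
  rewrite gmul_conj zk expnS; exists (gconj p * ((gnorm p ^ k)%:Z, 0)).
  by rewrite mulrA gmul_conj gmulE /=; congr pair; ring.
have [[w zw]|/gdvd_conj] := gprime_dvdM pp pzz.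
  have [v [j [v1 jk wE]]] := ih w (nzw w (etrans (congr1 gnorm (esym zw)) zk)).
  exists v, j.+1; split=> //; rewrite subSS zw wE exprS; ring.
rewrite gconjK => -[w zw].
have wk : gnorm w = (gnorm p ^ k)%N by apply: nzw; rewrite gnormM -zk zw gnormM gnorm_conj.
have [v [j [v1 jk wE]]] := ih w wk.
exists v, j; split=> //; first exact: leqW.
by rewrite subSn // zw wE exprS; ring.
Qed.

Lemma u_primepow p k j v : gprime p -> gnorm v = 1%N ->
  u (v * (p ^+ j * gconj p ^+ (k - j))) = u p ^+ j * (u p)^-1 ^+ (k - j).
Proof.
move=> pp v1; have p0 := gprime_neq0 pp.
have dX z n : dir R (z ^+ n) = dir R z ^+ n.
  elim: n => [|n ih]; last by rewrite !exprS dirM ih.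
  by rewrite !expr0 /dir /= sqrtr1 invr1 mulr1; apply/eqP; rewrite eq_complex /= !eqxx.
rewrite /= !dirM !dX (exprMn _ (dir R v)) (dir_unit R v1) mul1r.
rewrite (exprMn _ (dir R p ^+ j)) dir_conj // -!exprM -exprVn -exprM.
by rewrite [(j * 4)%N]mulnC [((k - j) * 4)%N]mulnC.
Qed.

Lemma lattice_seq_primepow p k : gprime p -> u p ^+ 2 != 1 ->
  perm_eq (lattice_seq (gnorm p ^ k))
    [seq v * (p ^+ j * gconj p ^+ (k - j)) | v <- gunits, j <- iota 0 k.+1].
Proof.
move=> pp u2; have p0 := gprime_neq0 pp.
have up0 := u_neq0 p0.
apply: uniq_perm; first exact: lattice_seq_uniq.
  apply: allpairs_uniq; [by []|exact: iota_uniq|].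
  move=> [v j] [v' j'] /allpairsP[[a b] [av bj [-> ->]]] /allpairsP[[a' b'] [av' bj' [-> ->]]].
  move: av av' bj bj'; cbv [fst snd]; move=> av av' bj bj' e.
  move: av av' bj bj'; rewrite !mem_gunits !mem_iota !add0n !ltnS /= => /eqP a1 /eqP a1' bk bk'.
  have := congr1 u e; rewrite /= !u_primepow // => e2.
  (* [u] ignores the unit and takes the value (u p)^(2 b - k). As u p is not a root of unity, this
     determines b, and cancelling then determines the unit. *)
  have e3 : u p ^+ (2 * b) = u p ^+ (2 * b').
    have h i : (i <= k)%N -> u p ^+ (2 * i) = u p ^+ i * (u p)^-1 ^+ (k - i) * u p ^+ k.
      move=> ik; rewrite -{2}(subnK ik) exprD mulrA -[X in X * _]mulrA -exprMn mulVf //.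
      by rewrite expr1n mulr1 -exprD; congr (_ ^+ _); lia.
    by rewrite !h // e2.
  have cmp i i' : (i < i')%N -> u p ^+ (2 * i) != u p ^+ (2 * i').
    move=> ii; have -> : (2 * i' = 2 * i + 2 * (i' - i))%N by lia.
    rewrite exprD -[X in X != _]mulr1 (inj_eq (mulfI (expf_neq0 (2 * i) up0))) eq_sym.
    by apply: not_root_of_unity => //; lia.
  have bb : b = b'.
    by case: (ltngtP b b') => // /cmp; rewrite e3 eqxx.
  move: e; rewrite -bb /= mulrC [a' * _]mulrC => /gmulI -> //.
  rewrite -gnorm_eq0 gnormM !gnormX gnorm_conj muln_eq0 !expn_eq0.
  by rewrite gnorm_eq0 (negPf p0).
move=> z; rewrite mem_lattice; apply/eqP/allpairsP => [/(lattice_primepow pp)|].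
  move=> [v [j [v1 jk ->]]]; exists (v, j); split; rewrite ?mem_gunits ?mem_iota ?add0n ?ltnS //.
  exact/eqP.
move=> [[v j] [+ + ->]]; cbv [fst snd]; rewrite mem_gunits mem_iota add0n ltnS => /eqP v1 jk.
by rewrite !gnormM v1 mul1n !gnormX gnorm_conj -expnD subnKC.
Qed.

Lemma N_primepow p k : gprime p -> u p ^+ 2 != 1 ->
  N (gnorm p ^ k) = (4 * k.+1)%N.
Proof.
move=> pp u2; rewrite /N (perm_size (lattice_seq_primepow k pp u2)).
by rewrite size_allpairs size_iota.
Qed.

Definition oddmean (w : R[i]) (m : nat) : R :=
  m.+1%:R^-1 * \sum_(i < m.+1) Re (w ^+ (2 * i).+1).

(** The exponents 2 j - (2 m + 1) run through the odd integers from -(2 m + 1) to 2 m + 1, and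
    opposite exponents have equal real parts. The induction strips off the two extreme ones. *)
Lemma sum_sym (w : R[i]) m : normc w = 1 ->
  \sum_(j < (2 * m).+2) Re (w ^+ j * w^-1 ^+ ((2 * m).+1 - j)) =
  2 * \sum_(i < m.+1) Re (w ^+ (2 * i).+1).
Proof.
move=> w1; have w0 : w != 0.
  by apply/eqP => h; move: w1; rewrite h normc0 => /eqP; rewrite eq_sym oner_eq0.
elim: m => [|m ih].
  rewrite muln0 big_ord_recl big_ord1 [in RHS]big_ord1 /= subn0 subnn !expr0 mul1r mulr1 muln0.
  by rewrite Re_expV // mulrDl mul1r.
rewrite [in RHS]big_ord_recr /= mulrDr -ih.
rewrite big_ord_recl big_ord_recr /= subn0 expr0 mul1r.
rewrite (_ : (2 * m.+1 = (2 * m).+2)%N); last by lia.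
rewrite /bump /= add1n subnn expr0 mulr1 Re_expV //.
rewrite addrCA mulrDl mul1r; congr (_ + _).
apply: eq_bigr => j _; rewrite /bump /= add1n !subSS subSn; last by rewrite -ltnS ltn_ord.
by rewrite [w ^+ _.+1]exprSr [w^-1 ^+ _.+1]exprS mulrA mulfK.
Qed.

Lemma nu_hat4_primepow p m : gprime p -> u p ^+ 2 != 1 ->
  nu_hat4 R (gnorm p ^ (2 * m).+1) = oddmean (u p) m.
Proof.
move=> pp u2; have p0 := gprime_neq0 pp.
rewrite nu_hat4_dir ?expn_gt0 ?gnorm_gt0 ?p0 // N_primepow //.
rewrite (perm_big _ (lattice_seq_primepow _ pp u2)) big_allpairs_dep.
rewrite big_seq (eq_bigr (fun=> 2 * \sum_(i < m.+1) Re (u p ^+ (2 * i).+1))); last first.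
  move=> v; rewrite mem_gunits => /eqP v1.
  under eq_bigr => j _ do rewrite u_primepow //.
  rewrite -sum_sym; last by rewrite normcX normc_dir // expr1n.
  have -> : iota 0 (2 * m).+2 = index_iota 0 (2 * m).+2 by rewrite /index_iota subn0.
  by rewrite big_mkord.
rewrite -big_seq big_const_seq count_predT iter_addr_0 /= /oddmean.
move: (\sum_(_ < _) _) => S; rewrite -mulr_natr.
have -> : (4 * (2 * m).+2)%:R = 8 * m.+1%:R :> R by rewrite -natrM; congr (_%:R); lia.
have : m.+1%:R != 0 :> R by rewrite pnatr_eq0.
by move: (m.+1%:R) => x x0; field.
Qed.

(** The square of u z is u p to the power 2 (2 j - (2 m + 1)), a nonzero exponent by parity. *)
Lemma primepow_axis p m z : gprime p -> u p ^+ 2 != 1 ->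
  gnorm z = (gnorm p ^ (2 * m).+1)%N -> u z ^+ 2 != 1.
Proof.
move=> pp u2 /(lattice_primepow pp)[v [j [v1 jm ->]]].
have up0 := u_neq0 (gprime_neq0 pp).
rewrite u_primepow // exprMn -[_ ^+ j ^+ 2]exprM -[_ ^+ (_ - j) ^+ 2]exprM exprVn.
have w0 := expf_neq0 (((2 * m).+1 - j) * 2) up0.
rewrite -[1](divff w0) (inj_eq (mulIf (invr_neq0 w0))).
have cmp i i' : (i < i')%N -> u p ^+ i != u p ^+ i'.
  move=> ii; rewrite -[i'](subnKC (ltnW ii)) exprD -[X in X != _]mulr1.
  rewrite (inj_eq (mulfI (expf_neq0 i up0))) eq_sym.
  by apply: not_root_of_unity => //; rewrite subn_gt0.
have [h|h] : (j * 2 < ((2 * m).+1 - j) * 2)%N \/ (((2 * m).+1 - j) * 2 < j * 2)%N by lia.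
  exact: cmp.
by rewrite eq_sym; exact: cmp.
Qed.

End PrimePower.

(** * Conclusion *)

Section Final.
Variable R : realType.
Implicit Types (z p : gauss).

Local Notation u := (fun z => dir R z ^+ 4).

Lemma Re_exp_le1 (w : R[i]) n : normc w = 1 -> `|Re (w ^+ n)| <= 1.
Proof. by move=> w1; apply: (le_trans (normc_Re _)); rewrite normcX w1 expr1n. Qed.

Lemma oddmean_norm_le1 (w : R[i]) m : normc w = 1 -> `|oddmean w m| <= 1.
Proof.
move=> w1; rewrite /oddmean normrM ger0_norm ?invr_ge0 // ler_pdivrMl // mulr1.
apply: (le_trans (ler_norm_sum _ _ _)).
apply: (@le_trans _ _ (\sum_(i < m.+1) 1)); last by rewrite sumr_const card_ord.
by apply: ler_sum => i _; exact: Re_exp_le1.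
Qed.

Lemma oddmean_step (w : R[i]) m : normc w = 1 ->
  `|oddmean w m.+1 - oddmean w m| <= 2 / m.+2%:R.
Proof.
move=> w1; have h1 := oddmean_norm_le1 m w1; have h2 := Re_exp_le1 (2 * m.+1).+1 w1.
have -> : oddmean w m.+1 - oddmean w m =
    (Re (w ^+ (2 * m.+1).+1) - oddmean w m) / m.+2%:R.
  rewrite /oddmean big_ord_recr /=; move: (\sum_(_ < _) _) (Re _) => S c.
  have : m.+1%:R != 0 :> R by rewrite pnatr_eq0.
  have : m.+2%:R != 0 :> R by rewrite pnatr_eq0.
  by rewrite -(natr1 m.+1); move: (m.+1%:R) => x y0 x0; field; rewrite x0 y0.
rewrite normrM normfV (ger0_norm (ler0n _ _)) ler_wpM2r ?invr_ge0 //.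
by apply: (le_trans (ler_normB _ _)); lra.
Qed.

(** Multiplied by 1 - w^2, the geometric sum telescopes to a difference of two numbers of modulus
    1. *)
Lemma oddmean_small (w : R[i]) m : normc w = 1 -> w ^+ 2 != 1 ->
  `|oddmean w m| <= 2 / normc (1 - w ^+ 2) / m.+1%:R.
Proof.
move=> w1 w2; have d0 : 0 < normc (1 - w ^+ 2).
  rewrite lt_def normc_ge0 andbT; apply: contra w2 => /eqP/eq0_normc/eqP.
  by rewrite subr_eq0 eq_sym.
rewrite /oddmean normrM ger0_norm ?invr_ge0 // mulrC ler_pM2r ?invr_gt0 //.
rewrite -(big_morph _ (@cReD R) (erefl : Re 0 = 0 :> R)).
apply: (le_trans (normc_Re _)); rewrite ler_pdivlMr // -normcM.
have -> : (\sum_(i < m.+1) w ^+ (2 * i).+1) * (1 - w ^+ 2) = w - w ^+ (2 * m.+1).+1.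
  elim: m => [|m ih]; first by rewrite big_ord1 muln0 muln1 mulrBr mulr1 -exprD.
  rewrite big_ord_recr /= mulrDl ih mulrBr mulr1 -exprD addrA subrK.
  by congr (_ - _ ^+ _); lia.
apply: (le_trans (normcD _ _)); rewrite normc_opp normcX w1 expr1n; lra.
Qed.

Lemma oddmean_start (w : R[i]) m : normc w = 1 ->
  1 - (2 * m).+1%:R * normc (1 - w) <= oddmean w m.
Proof.
move=> w1; rewrite /oddmean ler_pdivlMl //.
apply: (@le_trans _ _ (\sum_(i < m.+1) (1 - (2 * m).+1%:R * normc (1 - w)))).
  by rewrite sumr_const card_ord [leLHS]mulr_natl.
apply: ler_sum => i _.
have h : normc (1 - w ^+ (2 * i).+1) <= (2 * m).+1%:R * normc (1 - w).
  rewrite -[1](expr1n _ (2 * i).+1); apply: (le_trans (subX_normc _ _ _)).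
  - by rewrite normc1.
  - by rewrite w1.
  by rewrite expr1n ler_wpM2r ?normc_ge0 // ler_nat; have := ltn_ord i; lia.
have := normc_Re (1 - w ^+ (2 * i).+1); rewrite cReB /= ler_norml => /andP[_ h'].
lra.
Qed.

(* The means start near 1, tend to 0, and vary by at most [2 / m.+2] at each
   step, so they come close to every value in [[0, 1]]. *)
Lemma oddmean_approx (b d : R) (K : nat) : 0 <= b -> b <= 1 -> 0 < d ->
  exists p m, [/\ gprime p, u p ^+ 2 != 1, (K <= m)%N &
    `|oddmean (u p) m - b| <= d].
Proof.
move=> b0 b1; wlog d1 : d / d <= 1 => [H d0|d0].
  have [d1|/ltW d1] := leP d 1; first exact: H.
  have [p [m [h1 h2 h3 h4]]] := H 1 (lexx _) ltr01.
  by exists p, m; split=> //; apply: le_trans d1.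
(* From index J on, a step 2 / (m + 2) is at most d. *)
pose J := maxn K (Num.bound (2 / d)).
have KJ : (K <= J)%N by rewrite leq_maxl.
have hJ : 2 / d <= J%:R.
  apply: (@le_trans _ _ (Num.bound (2 / d))%:R); last by rewrite ler_nat leq_maxr.
  by apply/ltW/archi_boundP; rewrite divr_ge0 // ltW.
set c : R := (2 * J).+1%:R; have c1 : 1 <= c by rewrite ler1n.
have c0 : 0 < c by apply: lt_le_trans c1.
(* For |w| = 1 one has |1 - w|^2 = 2 (1 - Re w), so Re w > 1 - eta gives c |1 - w| <= d, which
   [oddmean_start] turns into a mean of at least 1 - d at index J. *)
pose eta := d ^+ 2 / (2 * c ^+ 2).
have cc0 : 0 < 2 * c ^+ 2 by rewrite mulr_gt0 // exprn_gt0.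
have e0 : 0 < eta by rewrite divr_gt0 // exprn_gt0.
have e1 : eta < 1.
  rewrite ltr_pdivrMr // mul1r (@le_lt_trans _ _ 1) ?expr_le1 ?(ltW d0) //.
  by rewrite expr2; nra.
have [p [pp u1 hu]] := small_angle_prime e0 e1.
have p0 := gprime_neq0 pp.
have w1 : normc (u p) = 1 by rewrite normcX normc_dir // expr1n.
have [w wE] : exists w, w = u p by exists (u p).
rewrite -wE in u1 hu w1.
have w2 : w ^+ 2 != 1.
  rewrite -[1](expr1n _ 2) eqf_sqr negb_or u1 /=; apply: contraTneq hu => ->.
  by rewrite -leNgt /=; lra.
have hn : c * normc (1 - w) <= d.
  rewrite -(@ler_pXn2r _ 2) // ?nnegrE ?mulr_ge0 ?normc_ge0 ?(ltW c0) ?(ltW d0) //.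
  have -> : (c * normc (1 - w)) ^+ 2 = 2 * c ^+ 2 * (1 - Re w).
    rewrite exprMn normc_sqr cReB cImB /=.
    have : Re w ^+ 2 + Im w ^+ 2 = 1 by rewrite -normc_sqr w1 expr1n.
    move: (Re w) (Im w) => x y xy.
    have yE : y ^+ 2 = 1 - x ^+ 2 by rewrite -xy addrAC subrr add0r.
    by transitivity (c ^+ 2 * ((1 - x) ^+ 2 + y ^+ 2)); [|rewrite yE]; ring.
  rewrite -ler_pdivlMl // mulrC -/eta; lra.
have hstart : 1 - d <= oddmean w J by apply: le_trans (oddmean_start J w1); rewrite -/c; lra.
have [m0 [Jm0 hm0]] : exists m, (J <= m)%N /\ oddmean w m <= b + d.
  pose D := 2 / normc (1 - w ^+ 2).
  pose m := maxn J (Num.bound (D / d)).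
  have D0 : 0 <= D by rewrite divr_ge0 // normc_ge0.
  exists m; rewrite leq_maxl; split=> //.
  have h := oddmean_small m w1 w2; rewrite -/D in h.
  have hm : D / d <= m.+1%:R.
    apply: (@le_trans _ _ (Num.bound (D / d))%:R); last by rewrite ler_nat leqW // leq_maxr.
    by apply/ltW/archi_boundP; rewrite divr_ge0 // ltW.
  apply: (le_trans (ler_norm _)); apply: (le_trans h).
  rewrite ler_pdivrMr //; move: hm; rewrite ler_pdivrMr // => hm.
  apply: (le_trans hm); rewrite mulrC ler_wpM2r //; lra.
(* Stop at the first m >= J where the mean is at most b + d. If m = J, the mean is at least 1 - d >=
   b - d; otherwise it exceeded b + d one step earlier and has dropped by at most d. *)
have ex : exists m, (J <= m)%N && (oddmean w m <= b + d) by exists m0; rewrite Jm0.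
case: (ex_minnP ex) => m /andP[Jm hm] mmin.
exists p, m; rewrite -wE; split=> //; first exact: leq_trans Jm.
rewrite ler_norml; apply/andP; split; last by lra.
move: Jm; rewrite leq_eqVlt => /orP[/eqP <-|Jm]; first by lra.
case: m hm mmin Jm => // m hm mmin Jm.
have : ~~ (oddmean w m <= b + d).
  apply/negP => h; have := mmin m; rewrite h -ltnS Jm /= => /(_ isT).
  by rewrite ltnn.
rewrite -ltNge => h.
have := oddmean_step m w1; rewrite ler_norml => /andP[hs _].
have : 2 / m.+2%:R <= d.
  rewrite ler_pdivrMr // mulrC -ler_pdivrMr //; apply: (le_trans hJ).
  by rewrite ler_nat leqW // ltnW.
move: (2 / _) (oddmean w m.+1) (oddmean w m) hs h => t x y hs h ht.
lra.
Qed.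

Lemma sums_of_two_squares_gnorm z : z != 0 -> sums_of_two_squares (gnorm z).
Proof. by move=> z0; split; rewrite ?gnorm_gt0 //; exists z.1, z.2; rewrite gnormE. Qed.

Lemma exists_approx (a d : R) (K : nat) : -1 <= a <= 1 -> 0 < d ->
  exists n, [/\ sums_of_two_squares n, (K <= N n)%N, `|nu_hat4 R n - a| <= d &
    forall z, gnorm z = n -> z.1 != 0 /\ z.2 != 0].
Proof.
move=> /andP[a1 a2] d0.
(* [u] is 1 on both axes. Squaring makes the criterion insensitive to the sign that the factor 1 + i
   brings in for negative a. *)
have axis z : z != 0 -> u z ^+ 2 != 1 -> z.1 != 0 /\ z.2 != 0.
  case: z => x y z0 uz; split; apply: contra uz => /eqP /= h.
    by rewrite h u_imag ?expr1n //; apply: contra z0 => /eqP ->; rewrite h.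
  by rewrite h u_real ?expr1n //; apply: contra z0 => /eqP ->; rewrite h.
have [a0|a0] := leP 0 a.
  have [p [m [pp u2 Km hm]]] := oddmean_approx K a0 a2 d0.
  exists (gnorm p ^ (2 * m).+1)%N; split.
  - by rewrite -gnormX; apply: sums_of_two_squares_gnorm; rewrite -gnorm_gt0 gnormX expn_gt0 gnorm_gt0 gprime_neq0.
  - by rewrite (N_primepow _ pp u2); lia.
  - by rewrite nu_hat4_primepow.
  move=> z zn; apply: axis; last exact: primepow_axis zn.
  by rewrite -gnorm_gt0 zn expn_gt0 gnorm_gt0 gprime_neq0.
have [||p [m [pp u2 Km hm]]] := @oddmean_approx (- a) d K _ _ d0; [lra|lra|].
have n0 : (0 < gnorm p ^ (2 * m).+1)%N by rewrite expn_gt0 gnorm_gt0 gprime_neq0.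
have c0 : ((1, 1) : gauss) != 0 by [].
exists (gnorm (1, 1)%R * gnorm p ^ (2 * m).+1)%N; split.
- rewrite -gnormX -gnormM; apply: sums_of_two_squares_gnorm.
  by rewrite -gnorm_gt0 gnormM gnormX muln_gt0 n0.
- by rewrite N_scale // ?(N_primepow _ pp u2); [lia|move=> z; exact: gdvd11].
- rewrite (nu_hat4_scale c0 n0 (u11 R) (@gdvd11 _)) nu_hat4_primepow //.
  by move: hm; rewrite -normrN mulN1r; congr (`|_| <= _); ring.
move=> z zn; apply: axis; first by rewrite -gnorm_gt0 zn muln_gt0 n0.
have [w zw] := gdvd11 zn.
have := u11 R; rewrite /= => u11'.
have -> : dir R z ^+ 4 = (-1)%:C * dir R w ^+ 4 by rewrite zw dirM -u11' -exprMn.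
rewrite (exprMn 2 (-1)%:C) (_ : (-1)%:C ^+ 2 = 1 :> R[i]); last first.
  by rewrite -rmorphXn /= sqrrN expr1n.
rewrite mul1r; apply: (primepow_axis (m := m) pp u2).
move: zn; rewrite zw gnormM => /eqP.
by rewrite eqn_pmul2l ?gnorm_gt0 ?c0 // => /eqP.
Qed.

Lemma scale9 n m : (0 < n)%N ->
  [/\ N (9 ^ m * n) = N n, nu_hat4 R (9 ^ m * n) = nu_hat4 R n &
   forall z, gnorm z = (9 ^ m * n)%N -> exists w : gauss,
     [/\ gnorm w = n, z.1 = 3 ^+ m * w.1 & z.2 = 3 ^+ m * w.2]].
Proof.
move=> n0; elim: m => [|m [ih1 ih2 ih3]].
  by rewrite mul1n; split=> // z zn; exists z; rewrite !mul1r.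
have c0 : ((3, 0) : gauss) != 0 by [].
have m0 : (0 < 9 ^ m * n)%N by rewrite muln_gt0 expn_gt0.
have -> : (9 ^ m.+1 * n = gnorm (3, 0)%R * (9 ^ m * n))%N by rewrite expnS mulnA.
split.
- by rewrite N_scale // => z; exact: gdvd3.
- by rewrite (nu_hat4_scale c0 m0 (u3 R) (@gdvd3 _)) mul1r.
move=> z zn; have [w zw] := gdvd3 zn.
have wn : gnorm w = (9 ^ m * n)%N.
  by move: zn; rewrite zw gnormM => /eqP; rewrite eqn_pmul2l => // /eqP.
have [w' [w'n h1 h2]] := ih3 w wn; exists w'; split=> //.
  by rewrite zw gmulE /= h1 exprS; ring.
by rewrite zw gmulE /= h2 exprS; ring.
Qed.

(* [m] absorbs any fixed [n], because [(9 ^ m)^(1/2)] is exactly [3 ^ m]. *)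
Lemma exists_scaling n (eps : R) : (0 < n)%N -> 0 < eps ->
  exists m, ((9 ^ m * n)%N%:R : R) `^ (1 / 2 - eps) < 3 ^+ m.
Proof.
move=> n0 e0; have n1 : (1 : R) <= n%:R by rewrite ler1n.
have l9 : 0 < ln (9 : R) by rewrite ln_gt0 // ltr1n.
(* After cancelling 3^m, it suffices that the square root of n be less than (9^m)^eps, which is at
   least 1 + eps m ln 9; any m above x will do. *)
pose x := Num.sqrt n%:R / (eps * ln (9 : R)).
have x0 : 0 <= x by rewrite divr_ge0 ?sqrtr_ge0 // mulr_ge0 // ltW.
exists (Num.bound x); have := archi_boundP x0; move: (Num.bound x) => m xm.
have m9 : (0 : R) < 9 ^+ m by rewrite exprn_gt0.
have nn0 : (0 : R) < (9 ^ m * n)%N%:R by rewrite ltr0n muln_gt0 expn_gt0.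
rewrite powRD; last by apply/implyP => _; rewrite gt_eqF.
rewrite mul1r powR12_sqrt ?(ltW nn0) // powRN ltr_pdivrMr ?powR_gt0 //.
rewrite natrM natrX sqrtrM ?(ltW m9) //.
have -> : Num.sqrt (9 ^+ m) = 3 ^+ m :> R.
  have -> : (9 : R) = 3 ^+ 2 by rewrite -natrX.
  by rewrite -exprM mulnC exprM sqrtr_sqr ger0_norm // exprn_ge0.
rewrite ltr_pM2l ?exprn_gt0 // powRM ?(ltW m9) //.
apply: (@lt_le_trans _ _ ((9 ^+ m) `^ eps)); last first.
  by rewrite ler_peMr ?powR_ge0 // -[leLHS](powRr0 n%:R) ler_powR // ltW.
rewrite /powR gt_eqF // lnXn //; apply: lt_le_trans (expR_ge1Dx _).
move: xm; rewrite ltr_pdivrMr ?mulr_gt0 // -[ln 9 *+ m]mulr_natl => xm.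
by rewrite mulrCA; lra.
Qed.

End Final.

Theorem lemma1p6 (R : realType) (eps : R) (l : nat) (a : R)
    (eps_gt0 : 0 < eps) (l_gt0 : (0 < l)%N) (a_itv : -1 <= a <= 1) :
  exists n : nat -> nat,
    [/\ forall i, sums_of_two_squares (n i),
        N (n i) @[i --> \oo] --> \oo,
        nu_hat4 R (n i) @[i --> \oo] --> a
      & forall (i : nat) (t : 'I_2),
          V t (n i) l ((n i)%:R `^ (1 / 2 - eps)) = set0 /\
          (forall xi : int * int, lattice_points (n i) xi ->
             (n i)%:R `^ (1 / 2 - eps) <= `|coord t xi|%:~R)].
Proof.
(* The index i controls both limits. The scaling 3^m is kept as a witness, because (i) and (ii) both
   come from divisibility of the coordinates by it. *)
have h i : exists n, [/\ sums_of_two_squares n, (i <= N n)%N,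
    `|nu_hat4 R n - a| <= i.+1%:R^-1 &
    exists m, (n%:R : R) `^ (1 / 2 - eps) < 3 ^+ m /\
    forall z, lattice_points n z -> exists w : gauss,
      [/\ w.1 != 0, w.2 != 0, z.1 = 3 ^+ m * w.1 & z.2 = 3 ^+ m * w.2]].
  have i0 : (0 : R) < i.+1%:R^-1 by rewrite invr_gt0.
  have [n0 [[n0p [x [y xy]]] hN hnu hz]] := exists_approx i a_itv i0.
  have [m hm] := exists_scaling n0p eps_gt0.
  have [h1 h2 h3] := scale9 R m n0p.
  exists (9 ^ m * n0)%N; split; rewrite ?h1 ?h2 //.
    split; first by rewrite muln_gt0 expn_gt0.
    exists (3 ^+ m * x), (3 ^+ m * y).
    rewrite PoszM xy !exprMn -!exprM mulnC exprM -mulrDr; congr (_ * _).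
    by rewrite -[Posz (9 ^ m)]natz natrX.
  exists m; split=> // z /lattice_pointsE/h3[w [wn e1 e2]].
  by have [w1 w2] := hz w wn; exists w.
have [n hn] := choice h; exists n.
have c3 m : (0 : R) < 3 ^+ m by rewrite exprn_gt0.
split.
- by move=> i; have [] := hn i.
- apply/cvgnyPge => A; near=> i.
  have [_ hN _ _] := hn i; apply: leq_trans hN; near: i.
  exact: nbhs_infty_ge.
- apply/cvgrPdist_le => e e0; near=> i.
  have [_ _ hnu _] := hn i; rewrite -normrN opprB; apply: (le_trans hnu).
  apply: ltW; near: i; exact: (near_infty_natSinv_lt (PosNum e0)).
move=> i t; have [_ _ _ [m [hm hz]]] := hn i.
have hc z : lattice_points (n i) z -> exists w : int, w != 0 /\ coord t z = 3 ^+ m * w.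
  move=> /hz[w [w1 w2 e1 e2]]; rewrite /coord; case: ifP => _.
    by exists w.1.
  by exists w.2.
have big (w : int) : w != 0 -> (3 ^+ m : R) <= `|3 ^+ m * w|%:~R.
  move=> w0; rewrite normrM intrM ger0_norm ?exprn_ge0 // rmorphXn /=.
  by rewrite ler_peMr ?(ltW (c3 m)) // ler1z; lia.
split; last first.
  move=> xi /hc[w [w0 ->]]; apply: le_trans (big w w0); exact: ltW.
apply/seteqP; split=> // xi [hxi] /andP[s0 sK].
have : exists w : int, \sum_(j < l) coord t (tnth xi j) = 3 ^+ m * w.
  have [f hf] := choice (fun j => hc _ (hxi j)).
  exists (\sum_(j < l) f j); rewrite mulr_sumr; apply: eq_bigr => j _.
  by case: (hf j).
move=> [w e]; move: s0 sK; rewrite e => s0 sK.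
have w0 : w != 0 by apply: contraTneq s0 => ->; rewrite mulr0 normr0 ltxx.
by have := le_lt_trans (le_trans (big w w0) sK) hm; rewrite ltxx.
Unshelve. all: by end_near.
Qed.
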